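(* For all partitions $\lambda,\mu$ the canonical stable Grothendieck functions satisfy: (i) $\omega(G^{(\alpha,\beta)}_\lambda)=G^{(\beta,\alpha)}_{\lambda'}$; (ii) $G^{(\alpha,\beta)}_\lambda G^{(\alpha,\beta)}_\mu=\sum_\nu(\alpha+\beta)^{|\nu|-|\lambda|-|\mu|}c^{\nu}_{\lambda\mu}G^{(\alpha,\beta)}_\nu$, a finite sum, where $c^\nu_{\lambda\mu}\in\mathbb{Z}_{\ge0}$ are the nonnegative integers defined by the (finite) expansion $G_\lambda G_\mu=\sum_\nu(-1)^{|\nu|-|\lambda|-|\mu|}c^\nu_{\lambda\mu}G_\nu$ of products of stable Grothendieck polynomials $G_\lambda=G^{(0,-1)}_\lambda$.
   Context: Let $\alpha,\beta$ be indeterminates. $\Lambda$ is the ring of symmetric functions in $x=(x_1,x_2,\ldots)$ over $\mathbb{Z}[\alpha,\beta]$ and $\hat\Lambda$ its completion (symmetric formal power series of unbounded degree, i.e. possibly infinite $\mathbb{Z}[\alpha,\beta]$-combinations of Schur functions $s_\lambda$). $\omega:\hat\Lambda\to\hat\Lambda$ is the involutive ring automorphism with $\omega(s_\lambda)=s_{\lambda'}$ ($\lambda'$ the conjugate partition). For a partition $\lambda$ (with $\lambda_j=0$ for $j>\ell(\lambda)$) and $n\ge1$, define the symmetric power series $G^{(\alpha,\beta)}_\lambda(x_1,\ldots,x_n)=\det\Big[\frac{x_i^{\lambda_j+n-j}(1+\beta x_i)^{j-1}}{(1-\alpha x_i)^{\lambda_j}}\Big]_{1\le i,j\le n}\Big/\prod_{1\le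 i<j\le n}(x_i-x_j)$. These satisfy $G^{(\alpha,\beta)}_\lambda(x_1,\ldots,x_n,0)=G^{(\alpha,\beta)}_\lambda(x_1,\ldots,x_n)$ and so define $G^{(\alpha,\beta)}_\lambda\in\hat\Lambda$ (the canonical stable Grothendieck function). $|\lambda|$ denotes the size of $\lambda$. *)

(* Defs.v *)
From HB Require Import structures.
From mathcomp Require Import all_boot all_order all_algebra.
From mathcomp Require Import perm finmap.
From mathcomp Require Import mpoly.
From mathcomp Require Import boolp.

Set Implicit Arguments.
Unset Strict Implicit.
Unset Printing Implicit Defensive.

Import GRing.Theory.
Local Open Scope ring_scope.

Definition is_partition (s : seq nat) := sorted geq s && (0 \notin s)%N.

Record intpart := IntPart {
  parts :> seq nat;
  _ : is_partition parts
}.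

HB.instance Definition _ := [isSub for parts].
HB.instance Definition _ := [Choice of intpart by <:].

Definition part_size (la : intpart) : nat := sumn la.

(* The i-th part (from 0) of the conjugate is the number of parts > i. *)
Definition conj_seq (s : seq nat) : seq nat :=
  mkseq (fun i => count (fun p => i < p)%N s) (head 0%N s).

Lemma conj_seq_is_partition (la : intpart) : is_partition (conj_seq la).
Proof.
apply/andP; split.
  apply: (@homo_sorted _ _ (fun i => count (fun p => i < p)%N la) leq).
    by move=> i j le_ij; apply: sub_count => p; apply: leq_ltn_trans.
  exact: iota_sorted.
apply/negP => /mapP[i]; rewrite mem_iota /= add0n => lt_i.
case: la lt_i => [[|p s] //= _] -> /=.
by rewrite add1n.
Qed.

Definition conj_part (la : intpart) : intpart :=
  IntPart (conj_seq_is_partition la).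

(* Formal power series in n variables: m |-> coefficient of 'X_[m]. *)
Record fps (R : comNzRingType) (n : nat) := Fps { fcoef : 'X_{1..n} -> R }.

Section PowerSeries.
Context {R : comNzRingType} {n : nat}.
Implicit Types (f g h : fps R n) (m : 'X_{1..n}).

Lemma fpsP f g : (forall m, fcoef f m = fcoef g m) -> f = g.
Proof. by case: f g => [f] [g] /= fg; congr Fps; apply/funext. Qed.

HB.instance Definition _ := gen_eqMixin (fps R n).
HB.instance Definition _ := gen_choiceMixin (fps R n).

Definition fps_zero : fps R n := Fps (fun=> 0).
Definition fps_opp f : fps R n := Fps (fun m => - fcoef f m).
Definition fps_add f g : fps R n := Fps (fun m => fcoef f m + fcoef g m).
Definition fps_one : fps R n := Fps (fun m => (m == 0%MM)%:R).
Definition fps_mul f g : fps R n :=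
  Fps (fun m =>
    \sum_(k : 'X_{1..n < (mdeg m).+1, (mdeg m).+1} | m == (k.1 + k.2)%MM)
       fcoef f k.1 * fcoef g k.2).
Definition fps_scale (a : R) f : fps R n := Fps (fun m => a * fcoef f m).

Fact fps_addA : associative fps_add.
Proof. by move=> f g h; apply: fpsP => m; exact: addrA. Qed.
Fact fps_addC : commutative fps_add.
Proof. by move=> f g; apply: fpsP => m; exact: addrC. Qed.
Fact fps_add0 : left_id fps_zero fps_add.
Proof. by move=> f; apply: fpsP => m; exact: add0r. Qed.
Fact fps_addN : left_inverse fps_zero fps_opp fps_add.
Proof. by move=> f; apply: fpsP => m; exact: addNr. Qed.

HB.instance Definition _ :=
  GRing.isZmodule.Build (fps R n) fps_addA fps_addC fps_add0 fps_addN.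

Definition fps_trunc (d : nat) f : {mpoly R[n]} :=
  \sum_(k : 'X_{1..n < d}) fcoef f k *: 'X_[k].

Lemma mcoeff_fps_trunc d f m :
  (mdeg m < d)%N -> (fps_trunc d f)@_m = fcoef f m.
Proof. by move=> lt_md; rewrite mcoeff_mpoly. Qed.

Lemma fcoef_mul d f g m : (mdeg m < d)%N ->
  fcoef (fps_mul f g) m = (fps_trunc d f * fps_trunc d g)@_m.
Proof.
move=> lt_md; rewrite mcoeffM /=; apply: eq_bigr => k /eqP def_m.
have leD : (mdeg k.1 + mdeg k.2 < d)%N by rewrite -mdegD -def_m.
by rewrite !mcoeff_fps_trunc //; apply: leq_ltn_trans leD;
   rewrite (leq_addr, leq_addl).
Qed.

Lemma fps_trunc_mul d f g p q m : (mdeg m < d)%N ->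
    (forall k, (mdeg k < d)%N -> fcoef f k = p@_k) ->
    (forall k, (mdeg k < d)%N -> fcoef g k = q@_k) ->
  fcoef (fps_mul f g) m = (p * q)@_m.
Proof.
move=> lt_md fp gq; rewrite mcoeffM /=; apply: eq_bigr => k /eqP def_m.
have leD : (mdeg k.1 + mdeg k.2 < d)%N by rewrite -mdegD -def_m.
by rewrite fp ?gq //; apply: leq_ltn_trans leD; rewrite (leq_addr, leq_addl).
Qed.

Fact fps_mulA : associative fps_mul.
Proof.
move=> f g h; apply: fpsP => m; set d := (mdeg m).+1.
have trP u k : (mdeg k < d)%N -> fcoef u k = (fps_trunc d u)@_k.
  by move=> lt_kd; rewrite mcoeff_fps_trunc.
have trM u v k : (mdeg k < d)%N ->
    fcoef (fps_mul u v) k = (fps_trunc d u * fps_trunc d v)@_k.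
  exact: fcoef_mul.
rewrite (fps_trunc_mul (ltnSn _) (trP f) (trM g h)) mulrA.
by rewrite (fps_trunc_mul (ltnSn _) (trM f g) (trP h)).
Qed.

Fact fps_mulC : commutative fps_mul.
Proof.
move=> f g; apply: fpsP => m.
by rewrite !(fcoef_mul _ _ (ltnSn (mdeg m))) mulrC.
Qed.

Fact fps_mul1 : left_id fps_one fps_mul.
Proof.
move=> f; apply: fpsP => m; set d := (mdeg m).+1.
have tr1 k : (mdeg k < d)%N -> fcoef fps_one k = (1 : {mpoly R[n]})@_k.
  by rewrite mcoeff1.
have trf k : (mdeg k < d)%N -> fcoef f k = (fps_trunc d f)@_k.
  by move=> lt_kd; rewrite mcoeff_fps_trunc.
by rewrite (fps_trunc_mul (ltnSn _) tr1 trf) mul1r -trf.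
Qed.

Fact fps_mulDl : left_distributive fps_mul fps_add.
Proof.
move=> f g h; apply: fpsP => m /=; rewrite -big_split /=.
by apply: eq_bigr => k _; rewrite mulrDl.
Qed.

Fact fps_one_neq0 : fps_one != 0.
Proof.
apply/eqP => /(congr1 (fun f => fcoef f 0%MM)) /=; rewrite eqxx => /eqP.
by rewrite oner_eq0.
Qed.

HB.instance Definition _ := GRing.Zmodule_isComNzRing.Build (fps R n)
  fps_mulA fps_mulC fps_mul1 fps_mulDl fps_one_neq0.

Lemma fcoefM d f g m : (mdeg m < d)%N ->
  fcoef (f * g) m = (fps_trunc d f * fps_trunc d g)@_m.
Proof. exact: fcoef_mul. Qed.

Fact fps_scaleA a b f : fps_scale a (fps_scale b f) = fps_scale (a * b) f.
Proof. by apply: fpsP => m /=; rewrite mulrA. Qed.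
Fact fps_scale1 : left_id 1 fps_scale.
Proof. by move=> f; apply: fpsP => m /=; rewrite mul1r. Qed.
Fact fps_scaleDr : right_distributive fps_scale +%R.
Proof. by move=> a f g; apply: fpsP => m /=; rewrite mulrDr. Qed.
Fact fps_scaleDl f : {morph fps_scale^~ f : a b / a + b}.
Proof. by move=> a b; apply: fpsP => m /=; rewrite mulrDl. Qed.

HB.instance Definition _ := GRing.Zmodule_isLmodule.Build R (fps R n)
  fps_scaleA fps_scale1 fps_scaleDr fps_scaleDl.

Fact fps_scaleAl (a : R) f g : a *: (f * g) = (a *: f) * g.
Proof.
apply: fpsP => m /=; rewrite mulr_sumr.
by apply: eq_bigr => k _; rewrite mulrA.
Qed.

HB.instance Definition _ := GRing.Lmodule_isLalgebra.Build R (fps R n)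
  fps_scaleAl.

Definition fps_var (i : 'I_n) : fps R n := Fps (fun m => (m == U_(i)%MM)%:R).

(* The quotient f / g when g divides f; it is then unique as soon as g is    *)
(* regular, which is the case of all the denominators below.                 *)
Definition fps_quot f g : fps R n :=
  if pselect (exists h, h * g = f) is left ex then sval (cid ex) else 0.

End PowerSeries.

(* The completion of the ring of symmetric functions, as the inverse limit   *)
(* over n of the rings of symmetric formal power series in n variables along *)
(* the maps that set the last variable to 0.                                 *)
Record symfun (R : comNzRingType) := SymFun {
  restr : forall n, fps R n;
  _ : forall n (s : 'S_n) (m : 'X_{1..n}),
        fcoef (restr n) [multinom m (s i) | i < n] = fcoef (restr n) m;
  _ : forall n (m : 'X_{1..n}),
        fcoef (restr n.+1) (mnmwiden m) = fcoef (restr n) m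
}.

Section SymmetricFunctions.
Context {R : comNzRingType}.
Implicit Types f g h : symfun R.

Lemma symfunP f g : (forall n, restr f n = restr g n) -> f = g.
Proof.
move=> eq_fg; have {eq_fg} : restr f = restr g.
  exact: functional_extensionality_dep.
case: f g => [f fs ft] [g gs gt] /= eq_fg; case: _ / eq_fg in gs gt *.
by congr SymFun; apply: Prop_irrelevance.
Qed.

Lemma restr_sym f n (s : 'S_n) (m : 'X_{1..n}) :
  fcoef (restr f n) [multinom m (s i) | i < n] = fcoef (restr f n) m.
Proof. by case: f. Qed.

Lemma restr_widen f n (m : 'X_{1..n}) :
  fcoef (restr f n.+1) (mnmwiden m) = fcoef (restr f n) m.
Proof. by case: f. Qed.

HB.instance Definition _ := gen_eqMixin (symfun R).
HB.instance Definition _ := gen_choiceMixin (symfun R).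

Program Definition symfun_zero : symfun R := @SymFun R (fun n => 0) _ _.

Program Definition symfun_opp f : symfun R :=
  @SymFun R (fun n => - restr f n) _ _.
Next Obligation. by rewrite /= restr_sym. Qed.
Next Obligation. by rewrite /= restr_widen. Qed.

Program Definition symfun_add f g : symfun R :=
  @SymFun R (fun n => restr f n + restr g n) _ _.
Next Obligation. by rewrite /= !restr_sym. Qed.
Next Obligation. by rewrite /= !restr_widen. Qed.

Program Definition symfun_scale (a : R) f : symfun R :=
  @SymFun R (fun n => a *: restr f n) _ _.
Next Obligation. by rewrite /= restr_sym. Qed.
Next Obligation. by rewrite /= restr_widen. Qed.

Program Definition symfun_one : symfun R := @SymFun R (fun n => 1) _ _.
Next Obligation.
by rewrite /= -!mdeg_eq0 mdeg_mperm.
Qed.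
Next Obligation.
congr (_ %:R); congr nat_of_bool; apply/eqP/eqP => [|->]; last exact: mnmwiden0.
by rewrite -mnmwiden0 => /inj_mnmwiden.
Qed.

Lemma fps_trunc_sym f n d : fps_trunc d (restr f n) \is symmetric.
Proof.
apply/issymP => s; apply/mpolyP => m; rewrite mcoeff_sym.
have [lt_md|le_dm] := ltnP (mdeg m) d.
  by rewrite !mcoeff_fps_trunc ?mdeg_mperm // restr_sym.
have tr0 (k : 'X_{1..n}) : (d <= mdeg k)%N -> (fps_trunc d (restr f n))@_k = 0.
  move=> le_dk; rewrite raddf_sum big1 //= => i _; rewrite mcoeffZ mcoeffX.
  case: eqP => [def_k|_]; last by rewrite mulr0.
  by move: (bmdeg i); rewrite def_k ltnNge le_dk.
by rewrite !tr0 ?mdeg_mperm.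
Qed.

Fact symfun_mul_sym f g n (s : 'S_n) (m : 'X_{1..n}) :
  fcoef (restr f n * restr g n) [multinom m (s i) | i < n]
    = fcoef (restr f n * restr g n) m.
Proof.
have lt_md := ltnSn (mdeg m).
rewrite [in RHS](fcoefM _ _ lt_md) [in LHS](@fcoefM _ _ (mdeg m).+1) ?mdeg_mperm //.
have /issymP/(_ s) := rpredM (fps_trunc_sym f n (mdeg m).+1)
                             (fps_trunc_sym g n (mdeg m).+1).
by move=> {2}<-; rewrite mcoeff_sym.
Qed.

Fact symfun_mul_widen f g n (m : 'X_{1..n}) :
  fcoef (restr f n.+1 * restr g n.+1) (mnmwiden m)
    = fcoef (restr f n * restr g n) m.
Proof.
set d := (mdeg (mnmwiden m)).+1.
have degw (k : 'X_{1..n}) : mdeg (mnmwiden k) = mdeg k.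
  rewrite !mdegE big_ord_recr /= mnmwiden_ordmax addn0.
  by apply: eq_bigr => i _; rewrite mnmwiden_widen.
have lt_md : (mdeg m < d)%N by rewrite /d degw.
rewrite [in RHS](fcoefM _ _ lt_md) -mwiden_mnmwiden rmorphM /= mcoeffM /=.
apply: eq_bigr => k /eqP def_m.
have leD : (mdeg k.1 + mdeg k.2 < d)%N by rewrite -mdegD -def_m.
have k0 : (k.1 ord_max + k.2 ord_max)%N = 0%N.
  by rewrite -mnmDE -def_m mnmwiden_ordmax.
have unw (j : 'X_{1..n.+1}) (h : symfun R) : (mdeg j < d)%N ->
    j ord_max = 0%N ->
    fcoef (restr h n.+1) j = (mwiden (fps_trunc d (restr h n)))@_j.
  move=> lt_jd j0.
  have {j0} def_j : j = mnmwiden [multinom j (widen_ord (leqnSn n) i) | i < n].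
    apply/mnmP => i; have [lt_in|] := ltnP i n.
      have -> : i = widen_ord (leqnSn n) (Ordinal lt_in) by apply: val_inj.
      by rewrite mnmwiden_widen mnmE.
    move=> le_ni; have -> : i = ord_max.
      by apply/val_inj/eqP; rewrite eqn_leq le_ni -ltnS ltn_ord.
    by rewrite mnmwiden_ordmax.
  rewrite def_j mwiden_mnmwiden restr_widen mcoeff_fps_trunc //.
  by rewrite -degw -def_j.
by rewrite !unw //; first [by apply: leq_ltn_trans leD;
   rewrite (leq_addr, leq_addl) | by move: k0; case: (k.1 _); case: (k.2 _)].
Qed.

Definition symfun_mul f g : symfun R :=
  SymFun (@symfun_mul_sym f g) (@symfun_mul_widen f g).

Fact symfun_addA : associative symfun_add.
Proof. by move=> f g h; apply: symfunP => n; exact: addrA. Qed.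
Fact symfun_addC : commutative symfun_add.
Proof. by move=> f g; apply: symfunP => n; exact: addrC. Qed.
Fact symfun_add0 : left_id symfun_zero symfun_add.
Proof. by move=> f; apply: symfunP => n; exact: add0r. Qed.
Fact symfun_addN : left_inverse symfun_zero symfun_opp symfun_add.
Proof. by move=> f; apply: symfunP => n; exact: addNr. Qed.

HB.instance Definition _ := GRing.isZmodule.Build (symfun R)
  symfun_addA symfun_addC symfun_add0 symfun_addN.

Fact symfun_mulA : associative symfun_mul.
Proof. by move=> f g h; apply: symfunP => n; exact: mulrA. Qed.
Fact symfun_mulC : commutative symfun_mul.
Proof. by move=> f g; apply: symfunP => n; exact: mulrC. Qed.
Fact symfun_mul1 : left_id symfun_one symfun_mul.
Proof. by move=> f; apply: symfunP => n; exact: mul1r. Qed.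
Fact symfun_mulDl : left_distributive symfun_mul symfun_add.
Proof. by move=> f g h; apply: symfunP => n; exact: mulrDl. Qed.
Fact symfun_one_neq0 : symfun_one != 0.
Proof.
by apply/eqP => /(congr1 (fun f => restr f 0)) /eqP; rewrite oner_eq0.
Qed.

HB.instance Definition _ := GRing.Zmodule_isComNzRing.Build (symfun R)
  symfun_mulA symfun_mulC symfun_mul1 symfun_mulDl symfun_one_neq0.

Fact symfun_scaleA a b f :
  symfun_scale a (symfun_scale b f) = symfun_scale (a * b) f.
Proof. by apply: symfunP => n; exact: scalerA. Qed.
Fact symfun_scale1 : left_id 1 symfun_scale.
Proof. by move=> f; apply: symfunP => n; exact: scale1r. Qed.
Fact symfun_scaleDr : right_distributive symfun_scale +%R.
Proof. by move=> a f g; apply: symfunP => n; exact: scalerDr. Qed.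
Fact symfun_scaleDl f : {morph symfun_scale^~ f : a b / a + b}.
Proof. by move=> a b; apply: symfunP => n; exact: scalerDl. Qed.

HB.instance Definition _ := GRing.Zmodule_isLmodule.Build R (symfun R)
  symfun_scaleA symfun_scale1 symfun_scaleDr symfun_scaleDl.

Fact symfun_scaleAl (a : R) f g : a *: (f * g) = (a *: f) * g.
Proof. by apply: symfunP => n; exact: scalerAl. Qed.

HB.instance Definition _ := GRing.Lmodule_isLalgebra.Build R (symfun R)
  symfun_scaleAl.

(* The element of the completion with prescribed restrictions F n to n       *)
(* variables for all n >= N; by stability these determine it.                *)
Definition symfun_of (N : nat) (F : forall n, fps R n) : symfun R :=
  if pselect (exists f : symfun R, forall n, (N <= n)%N -> restr f n = F n)
  is left ex then sval (cid ex) else 0.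

(* f is the sum of the family u: each coefficient of f is the common value   *)
(* of that coefficient in all large enough finite partial sums.              *)
Definition has_sum (I : choiceType) (u : I -> symfun R) f :=
  forall n (m : 'X_{1..n}), exists S0 : {fset I}, forall S : {fset I},
    (S0 `<=` S)%fset ->
    fcoef (restr (\sum_(i <- S) u i) n) m = fcoef (restr f n) m.

Definition vandermonde n : fps R n :=
  \prod_(i < n) \prod_(j < n | (i < j)%N) (fps_var i - fps_var j).

(* Rows and columns are numbered from 0, so that j below is j - 1 in the     *)
(* usual formulas. The bialternant is taken for n >= l(la) variables only:   *)
(* for n < l(la) its numerator forgets the parts la_j with j > n, whereas    *)
(* the restriction to n variables of the symmetric function vanishes.        *)
Definition schur (la : intpart) : symfun R :=
  symfun_of (size la) (fun n =>
    fps_quot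
      (\det (\matrix_(i < n, j < n) fps_var i ^+ (nth 0 la j + (n - j.+1))%N))
      (vandermonde n)).

(* G^(a,b)_la *)
Definition grothendieck (a b : R) (la : intpart) : symfun R :=
  symfun_of (size la) (fun n =>
    fps_quot
      (\det (\matrix_(i < n, j < n)
         fps_quot (fps_var i ^+ (nth 0 la j + (n - j.+1))%N
                     * (1 + b *: fps_var i) ^+ j)
                  ((1 - a *: fps_var i) ^+ nth 0%N la j)))
      (vandermonde n)).

(* omega (\sum_la c_la s_la) = \sum_la c_la s_la', for infinite sums. *)
Definition omega f : symfun R :=
  if pselect (exists g, exists c : intpart -> R,
       has_sum (fun la => c la *: schur la) f
       /\ has_sum (fun la => c la *: schur (conj_part la)) g)
  is left ex then sval (cid ex) else 0.

End SymmetricFunctions.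

Arguments omega {R} f.

Definition Zab : comNzRingType := {mpoly int[2]}.
Definition alpha : Zab := 'X_ord0.
Definition beta : Zab := 'X_ord_max.

(* Main.v *)
Require Import Defs.
From HB Require Import structures.
From mathcomp Require Import all_boot all_order all_algebra.
From mathcomp Require Import perm finmap mpoly boolp zify ring.

(* Expanding columns, the coefficient of s_nu in G^(a,b)_la is the            *)
(* determinant of [x^(nu_i - i - la_j + j)] (1 + b x)^(j-1) (1 - a x)^-la_j.  *)
(* Put the n + m boundary steps of la inside an n x m box on the positions    *)
(* 0, ..., n + m - 1. This determinant is then the minor, on the rows given   *)
(* by the vertical steps of nu and the columns given by the vertical steps of *)
(* la, of a unitriangular matrix whose inverse is explicit on the horizontal  *)
(* steps; Jacobi's complementary minor theorem identifies it with the         *)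
(* coefficient of s_nu' in G^(b,a)_la', which is (i). For (ii), the           *)
(* substitution x -> - (a + b) x / (1 - a x) carries the bialternants of      *)
(* G^(0,-1) to those of G^(a,b), up to the factor (- (a + b))^|la| and a      *)
(* factor independent of la; since G_la starts in degree |la|, only the nu    *)
(* with |nu| >= |la| + |mu| occur and the powers of a + b can be cancelled.   *)

Set Implicit Arguments.
Unset Strict Implicit.
Unset Printing Implicit Defensive.

Import Order.TTheory GRing.Theory Num.Theory.
Local Open Scope ring_scope.

(** * Formal power series *)

(** In n >= l(la) variables, the Vandermonde product V times G^(a,b)_la is the alternant of the
    columns [gcol] ([restr_grothendieck]), and V is regular, so both claims become statements on
    determinants. The coefficient of s_nu in f is that of x^(nu + delta) in V f. Alternating series
    are determined by their coefficients at strictly decreasing exponents, so these numbers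
    determine f ([has_sum_schur], [schur_coef_inj]), and omega merely conjugates their index
    ([omegaE]).

    For (i) it remains to prove [schur_coef_conj]: the coefficient of s_nu in G^(a,b)_la is that of
    s_nu' in G^(b,a)_la'. The first is a minor of [col_mx_of] on the vertical steps. The inverse is
    [row_mx_of] ([row_col_mx]), because a column series times a row series is a polynomial of too
    small a degree to reach the coefficient in question. Jacobi's theorem yields the complementary
    minor, on the horizontal steps; the substitution x -> -x turns it into the second coefficient,
    and the signs agree by a count of the inversions of the boundary path ([odd_step_perm]).

    For (ii), the given expansion over the integers is an identity between polynomial numerators
    ([restr_mul_alternant]). The substitution [mobius] carries it to the numerators for (a,b), with
    an extra power of -(a + b) for each nu. By [product_support] all these powers are at least the
    one on the left, which can then be cancelled ([grothendieck_mul]). *)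

Section Coefficients.
Context {R : comNzRingType} {n : nat}.
Implicit Types (f g : fps R n) (m : 'X_{1..n}).

Lemma lem_mdeg m k : (k <= m)%MM -> (mdeg k <= mdeg m)%N.
Proof. by move=> /submK <-; rewrite mdegD leq_addl. Qed.

Lemma fcoefM_lin f g m : fcoef (f * g) m =
  \sum_(k : 'X_{1..n < (mdeg m).+1} | (k <= m)%MM) fcoef f k * fcoef g (m - k)%MM.
Proof.
rewrite (fcoefM _ _ (ltnSn _)) (@mcoeff_poly_mul_lin _ _ _ _ _ (mdeg m).+1) //.
apply: eq_bigr => k le_km; rewrite !mcoeff_fps_trunc ?ltnS ?lem_mdeg //.
exact: lem_subr.
Qed.

Lemma fcoefM_only f g m k : (k <= m)%MM ->
    (forall l, (l <= m)%MM -> l != k -> fcoef f l * fcoef g (m - l)%MM = 0) ->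
  fcoef (f * g) m = fcoef f k * fcoef g (m - k)%MM.
Proof.
move=> le_km fg0; have lt_k : (mdeg k < (mdeg m).+1)%N by rewrite ltnS lem_mdeg.
rewrite fcoefM_lin (bigD1 (BMultinom lt_k)) //= big1 ?addr0 // => l.
by case/andP; exact: fg0.
Qed.

Lemma fcoef_sum (I : Type) (r : seq I) (P : pred I) (F : I -> fps R n) m :
  fcoef (\sum_(i <- r | P i) F i) m = \sum_(i <- r | P i) fcoef (F i) m.
Proof. by elim/big_rec2: _ => // i x y _ <-. Qed.

Lemma fps_scalerAr a f g : f * (a *: g) = a *: (f * g).
Proof. by rewrite mulrC -scalerAl mulrC. Qed.

Lemma fps_exprZ1 a k : (a *: 1 : fps R n) ^+ k = a ^+ k *: 1.
Proof.
elim: k => [|k IHk]; first by rewrite scale1r.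
by rewrite !exprS IHk -scalerAl mul1r scalerA.
Qed.

Lemma fcoef_signM (b : bool) f m : fcoef ((-1) ^+ b * f) m = (-1) ^+ b * fcoef f m.
Proof. by case: b; rewrite ?expr1 ?expr0 ?mulN1r ?mul1r. Qed.

Lemma fcoef_varM i f m : fcoef (fps_var i * f) m =
  if m i == 0%N then 0 else fcoef f (m - U_(i))%MM.
Proof.
rewrite fcoefM_lin /=; case: eqP => [mi0|/eqP mi_gt0].
  rewrite big1 // => k le_km; case: eqP => [def_k|]; last by rewrite mul0r.
  by move/mnm_lepP/(_ i): le_km; rewrite def_k mi0 mnm1E eqxx.
have lt_U : (mdeg U_(i)%MM < (mdeg m).+1)%N.
  by rewrite mdeg1 ltnS mdegE (bigD1 i) //= addn_gt0 lt0n mi_gt0.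
rewrite (bigD1 (BMultinom lt_U)) ?lep1mP //= eqxx mul1r big1 ?addr0 // => k.
by move=> /andP[_]; rewrite bmeqP /= => /negPf->; rewrite mul0r.
Qed.

End Coefficients.

(** When the image of the additive embedding t is closed under divisors, every factorization of t m
    comes from one of m. This makes substitution of one variable, permutation of variables and
    restriction multiplicative. *)
Lemma fcoefM_pull (R : comNzRingType) n n' (f g : fps R n)
    (t : 'X_{1..n'} -> 'X_{1..n}) (u : 'X_{1..n} -> 'X_{1..n'}) m :
    cancel t u -> {morph t : a b / (a + b)%MM} ->
    (forall a, mdeg (t a) = mdeg a) ->
    (forall k a, (k <= t a)%MM -> t (u k) = k) ->
  fcoef (f * g) (t m) =
  fcoef (Fps (fun a => fcoef f (t a)) * Fps (fun a => fcoef g (t a))) m.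
Proof.
move=> tK tD tdeg t_surj; rewrite !fcoefM_lin.
have lt_t (k : 'X_{1..n' < (mdeg m).+1}) : (mdeg (t k) < (mdeg (t m)).+1)%N.
  by rewrite !tdeg bmdeg.
have le_t (k : 'X_{1..n'}) : (k <= m)%MM -> (t k <= t m)%MM.
  by move=> /submK <-; rewrite tD lem_addl.
rewrite (reindex_onto (fun k => BMultinom (lt_t k))
   (fun k : 'X_{1..n < (mdeg (t m)).+1} => insubd bm0 (u k))) /=; last first.
  move=> k le_k; apply: val_inj => /=; have tuk := t_surj _ _ le_k.
  rewrite /insubd insubT /=; last by move=> _; exact: tuk.
  by rewrite -tdeg tuk -(tdeg m) bmdeg.
have le_u (k : 'X_{1..n'}) : (t k <= t m)%MM -> (k <= m)%MM.
  move=> le_k; have <- : (u (t m - t k)%MM + k)%MM = m; last exact: lem_addl.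
  by apply: (can_inj tK); rewrite tD (t_surj _ m) ?submK ?lem_subr.
have uK (k : 'X_{1..n' < (mdeg m).+1}) : insubd bm0 (u (t k)) = k.
  by apply: val_inj; rewrite /insubd tK insubT ?bmdeg //=.
apply: eq_big => [k|k /andP[le_k _]].
  by rewrite uK eqxx andbT; apply/idP/idP; [exact: le_u|exact: le_t].
by congr (_ * fcoef g _); rewrite -{1}(submK (le_u _ le_k)) tD addmK.
Qed.

Lemma ord1E (i : 'I_1) : i = ord0.
Proof. by apply: val_inj; case: i => [[]]. Qed.

Section Univariate.
Context {R : comNzRingType}.
Implicit Types (f g : fps R 1) (a : R).

Definition ucoef f k : R := fcoef f [multinom k | _ < 1].

Lemma mnm_ord1 (m : 'X_{1..1}) : [multinom m ord0 | _ < 1] = m.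
Proof. by apply/mnmP => i; rewrite mnmE (ord1E i). Qed.

Lemma ucoefP f g : (forall k, ucoef f k = ucoef g k) -> f = g.
Proof. by move=> fg; apply: fpsP => m; have := fg (m ord0); rewrite /ucoef mnm_ord1. Qed.

Lemma ucoefM f g k : ucoef (f * g) k = \sum_(i < k.+1) ucoef f i * ucoef g (k - i).
Proof.
rewrite /ucoef fcoefM_lin; set m := [multinom k | _ < 1].
have degm j : mdeg [multinom j | _ < 1] = j by rewrite mdegE big_ord1 mnmE.
have lt_d (i : 'I_k.+1) : (mdeg [multinom (i : nat) | _ < 1%N] < (mdeg m).+1)%N.
  by rewrite !degm.
rewrite (reindex_onto (fun i => BMultinom (lt_d i))
           (fun d : 'X_{1..1 < (mdeg m).+1} => inord (d ord0))) /=; last first.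
  move=> d /mnm_lepP/(_ ord0); rewrite mnmE => le_d; apply: val_inj => /=.
  by rewrite inordK ?ltnS // mnm_ord1.
apply: eq_big => [i|i _]; first rewrite mnmE inord_val eqxx andbT.
  by apply/mnm_lepP => j; rewrite !mnmE -ltnS.
by congr (_ * fcoef g _); apply/mnmP => j; rewrite mnmBE !mnmE.
Qed.

Lemma ucoefB f g k : ucoef (f - g) k = ucoef f k - ucoef g k.
Proof. by []. Qed.

Lemma ucoefZ a f k : ucoef (a *: f) k = a * ucoef f k.
Proof. by []. Qed.

Lemma ucoef1 k : ucoef 1 k = (k == 0%N)%:R.
Proof. by rewrite /ucoef /= -mdeg_eq0 mdegE big_ord1 mnmE. Qed.

Definition uX : fps R 1 := fps_var ord0.

Lemma ucoefXM f k : ucoef (uX * f) k = if k is k'.+1 then ucoef f k' else 0.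
Proof.
rewrite /ucoef fcoef_varM mnmE; case: k => //= k; congr (fcoef f _).
by apply/mnmP => i; rewrite mnmBE !mnmE (ord1E i) subn1.
Qed.

Lemma ucoefXnM j f k :
  ucoef (uX ^+ j * f) k = if (j <= k)%N then ucoef f (k - j) else 0.
Proof.
elim: j k => [|j IHj] [|k]; rewrite ?mul1r ?subn0 // exprS -mulrA ucoefXM //.
Qed.

(** The series 1 / (1 - a x), which turns the denominators into factors. *)
Definition geo a : fps R 1 := Fps (fun m => a ^+ m ord0).

Lemma ucoef_geo a k : ucoef (geo a) k = a ^+ k.
Proof. by rewrite /ucoef /= mnmE. Qed.

Lemma geoV a : geo a * (1 - a *: uX) = 1.
Proof.
apply: ucoefP => k; rewrite mulrBr mulr1 [X in _ - X]mulrC -scalerAl.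
rewrite ucoefB ucoefZ ucoefXM ucoef_geo ucoef1.
case: k => [|k]; first by rewrite mulr0 subr0.
by rewrite ucoef_geo exprS subrr.
Qed.

Lemma geo0 : geo 0 = 1.
Proof. by rewrite -[LHS]mulr1 -[RHS](geoV 0) scale0r subr0. Qed.

End Univariate.

Section Embedding.
Context {R : comNzRingType} {n : nat} (i : 'I_n).
Implicit Types (f g : fps R 1) (m : 'X_{1..n}).

(** The series f(x_i), supported on the powers of x_i. *)
Definition emb f : fps R n :=
  Fps (fun m => if m == (U_(i) *+ m i)%MM then ucoef f (m i) else 0).

Lemma emb_axis f m k : m = (U_(i) *+ k)%MM -> fcoef (emb f) m = ucoef f k.
Proof. by move=> -> /=; rewrite mulmnE mnm1E eqxx mul1n eqxx. Qed.

Lemma emb_off f m : m != (U_(i) *+ m i)%MM -> fcoef (emb f) m = 0.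
Proof. by move=> /negPf /= ->. Qed.

Lemma le_axis k m : (k <= m)%MM -> m = (U_(i) *+ m i)%MM -> k = (U_(i) *+ k i)%MM.
Proof.
move=> /mnm_lepP le_km /mnmP def_m; apply/mnmP => j.
have := le_km j; rewrite {1}def_m !mulmnE !mnm1E.
by case: eqVneq => [->|_]; rewrite ?mul1n // !mul0n leqn0 => /eqP.
Qed.

Fact emb_zmod : zmod_morphism emb.
Proof. by move=> f g; apply: fpsP => m /=; case: ifP => //; rewrite subr0. Qed.

Fact emb_monoid : monoid_morphism emb.
Proof.
split=> [|f g]; apply: fpsP => m.
  have [def_m|m_off] := eqVneq m (U_(i) *+ m i)%MM.
    rewrite (emb_axis _ def_m) ucoef1 /= -mdeg_eq0 {2}def_m.
    by rewrite mdegMn mdeg1 mul1n.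
  rewrite emb_off //=; case: (eqVneq m 0%MM) => // m0.
  by rewrite m0 mnm0E mulm0n eqxx in m_off.
have [def_m|m_off] := eqVneq m (U_(i) *+ m i)%MM; last first.
  rewrite emb_off // fcoefM_lin big1 // => k le_km.
  have [def_k|k_off] := eqVneq (k : 'X_{1..n}) (U_(i) *+ k i)%MM; last first.
    by rewrite emb_off ?mul0r.
  rewrite (@emb_off g) ?mulr0 //; apply: contraNneq m_off => def_mk.
  rewrite -(submK le_km) def_mk def_k; apply/eqP/mnmP => j.
  by rewrite mnmDE !mulmnE mnmDE !mulmnE !mnm1E eqxx !mul1n mulnDr.
rewrite (emb_axis _ def_m).
pose t (a : 'X_{1..1}) : 'X_{1..n} := (U_(i) *+ a ord0)%MM.
pose u (k : 'X_{1..n}) := [multinom k i | _ < 1].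
have -> : m = t (u m) by rewrite /t mnmE.
have tdeg a : mdeg (t a) = mdeg a.
  by rewrite mdegMn mdeg1 mul1n mdegE big_ord1.
rewrite (@fcoefM_pull _ _ _ _ _ t u) //.
- have embK (h : fps R 1) : Fps (fun a => fcoef (emb h) (t a)) = h.
    by apply: fpsP => a; rewrite [LHS](emb_axis _ (erefl (t a))) /ucoef mnm_ord1.
  by rewrite !embK /ucoef /u /t mulmnE mnm1E eqxx mul1n mnmE.
- by move=> a; apply/mnmP => j; rewrite mnmE (ord1E j) mulmnE mnm1E eqxx mul1n.
- by move=> a b; apply/mnmP => j; rewrite mnmDE !mulmnE mnmDE mulnDr.
- move=> k a le_ka; rewrite /t mnmE -(le_axis le_ka) //.
  by rewrite /t mulmnE mnm1E eqxx mul1n.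
Qed.

HB.instance Definition _ :=
  GRing.isZmodMorphism.Build (fps R 1) (fps R n) emb emb_zmod.
HB.instance Definition _ :=
  GRing.isMonoidMorphism.Build (fps R 1) (fps R n) emb emb_monoid.

Lemma embZ a f : emb (a *: f) = a *: emb f.
Proof. by apply: fpsP => m /=; case: ifP; rewrite ?mulr0. Qed.

Lemma embX : emb uX = fps_var i.
Proof.
apply: fpsP => m /=; case: eqP => [def_m|m_off]; last first.
  case: (eqVneq m U_(i)%MM) => // mU.
  by rewrite mU mnm1E eqxx mulm1n in m_off.
have eqm : (m == U_(i)%MM) = (m i == 1%N).
  apply/eqP/eqP => [->|mi1]; first by rewrite mnm1E eqxx.
  by rewrite def_m mi1 mulm1n.
rewrite eqm /ucoef /=; congr (nat_of_bool _)%:R; apply/eqP/eqP => [|->].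
  by move/mnmP/(_ ord0); rewrite !mnmE.
by apply/mnmP => j; rewrite !mnmE (ord1E j).
Qed.

End Embedding.

Arguments emb : simpl never.

Section Permutation.
Context {R : comNzRingType} {n : nat} (s : 'S_n).

Definition fps_perm (f : fps R n) : fps R n :=
  Fps (fun m => fcoef f [multinom m (s i) | i < n]).

Fact fps_perm_zmod : zmod_morphism fps_perm.
Proof. by []. Qed.

Fact fps_perm_monoid : monoid_morphism fps_perm.
Proof.
split=> [|f g]; apply: fpsP => m /=; first by rewrite -!mdeg_eq0 mdeg_mperm.
rewrite [LHS](@fcoefM_pull _ _ _ f g (fun a : 'X_{1..n} => [multinom a (s i) | i < n])
  (fun a => [multinom a (s^-1 i)%g | i < n]) m) //.
- by move=> a; apply/mnmP => j; rewrite !mnmE permKV.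
- by move=> a b; apply/mnmP => j; rewrite !(mnmDE, mnmE).
- by move=> a; rewrite mdeg_mperm.
- by move=> k a _; apply/mnmP => j; rewrite !mnmE permK.
Qed.

HB.instance Definition _ :=
  GRing.isZmodMorphism.Build (fps R n) (fps R n) fps_perm fps_perm_zmod.
HB.instance Definition _ :=
  GRing.isMonoidMorphism.Build (fps R n) (fps R n) fps_perm fps_perm_monoid.

End Permutation.

Section Restriction.
Context {R : comNzRingType} {n : nat}.

(** The last variable is set to 0. *)
Definition fps_res (f : fps R n.+1) : fps R n :=
  Fps (fun m => fcoef f (mnmwiden m)).

Lemma mdeg_widen (m : 'X_{1..n}) : mdeg (mnmwiden m) = mdeg m.
Proof.
rewrite !mdegE big_ord_recr /= mnmwiden_ordmax addn0.
by apply: eq_bigr => i _; rewrite mnmwiden_widen.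
Qed.

Fact fps_res_zmod : zmod_morphism fps_res.
Proof. by []. Qed.

Lemma mnmwiden_surj (k : 'X_{1..n.+1}) : k ord_max = 0%N ->
  mnmwiden [multinom k (widen_ord (leqnSn n) i) | i < n] = k.
Proof.
move=> k0; apply/mnmP => i; have [lt_in|le_ni] := ltnP i n.
  have -> : i = widen_ord (leqnSn n) (Ordinal lt_in) by apply: val_inj.
  by rewrite mnmwiden_widen mnmE.
suff -> : i = ord_max by rewrite mnmwiden_ordmax k0.
by apply/val_inj/eqP; rewrite eqn_leq le_ni -ltnS ltn_ord.
Qed.

Fact fps_res_monoid : monoid_morphism fps_res.
Proof.
split=> [|f g]; apply: fpsP => m /=; first by rewrite -!mdeg_eq0 mdeg_widen.
rewrite [LHS](@fcoefM_pull _ _ _ f g (@mnmwiden n)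
  (fun a => [multinom a (widen_ord (leqnSn n) i) | i < n]) m) //.
- by move=> a; apply/mnmP => j; rewrite mnmE mnmwiden_widen.
- by move=> a b; rewrite mnmwidenD.
- exact: mdeg_widen.
- move=> k a /mnm_lepP/(_ ord_max); rewrite mnmwiden_ordmax leqn0 => /eqP.
  exact: mnmwiden_surj.
Qed.

HB.instance Definition _ :=
  GRing.isZmodMorphism.Build (fps R n.+1) (fps R n) fps_res fps_res_zmod.
HB.instance Definition _ :=
  GRing.isMonoidMorphism.Build (fps R n.+1) (fps R n) fps_res fps_res_monoid.

Lemma fps_resM (f g : fps R n.+1) : fps_res (f * g) = fps_res f * fps_res g.
Proof. exact: rmorphM. Qed.

End Restriction.

Section Twist.
Context {R : comNzRingType} {n : nat}.

(** The substitution x -> -x, which relates the complementary minor of the duality to the conjugate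
    partition. *)
Definition fps_twist (f : fps R n) : fps R n :=
  Fps (fun m => (-1) ^+ mdeg m * fcoef f m).

Fact fps_twist_zmod : zmod_morphism fps_twist.
Proof. by move=> f g; apply: fpsP => m; rewrite /= -mulrN -mulrDr. Qed.

Fact fps_twist_monoid : monoid_morphism fps_twist.
Proof.
split=> [|f g]; apply: fpsP => m.
  by rewrite /=; case: eqP => [->|]; rewrite ?mulr0 // mdeg0 mulr1.
rewrite -[LHS]/((-1) ^+ mdeg m * fcoef (f * g) m) !fcoefM_lin mulr_sumr.
apply: eq_bigr => k le_km; rewrite /= [RHS]mulrACA -exprD -mdegD addmC submK //.
Qed.

HB.instance Definition _ :=
  GRing.isZmodMorphism.Build (fps R n) (fps R n) fps_twist fps_twist_zmod.
HB.instance Definition _ :=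
  GRing.isMonoidMorphism.Build (fps R n) (fps R n) fps_twist fps_twist_monoid.

Lemma fps_twistZ a f : fps_twist (a *: f) = a *: fps_twist f.
Proof. by apply: fpsP => m; rewrite /= mulrCA. Qed.

Lemma fps_twist_var i : fps_twist (fps_var i) = - fps_var i.
Proof.
apply: fpsP => m /=; case: eqP => [->|_]; last by rewrite mulr0 oppr0.
by rewrite mdeg1 mulr1.
Qed.

End Twist.

Lemma ucoef_twist (R : comNzRingType) (f : fps R 1) k :
  ucoef (fps_twist f) k = (-1) ^+ k * ucoef f k.
Proof. by rewrite /ucoef /= mdegE big_ord1 mnmE. Qed.

Lemma twist_geo (R : comNzRingType) (a : R) : fps_twist (geo a) = geo (- a).
Proof.
by apply: ucoefP => k; rewrite ucoef_twist !ucoef_geo -exprMn mulN1r.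
Qed.

Lemma fps_twist_units (R : comNzRingType) (a b : R) i j :
  fps_twist ((1 + a *: uX) ^+ i * geo b ^+ j) = (1 - a *: uX) ^+ i * geo (- b) ^+ j.
Proof.
have twX (f : fps R 1) k : fps_twist (f ^+ k) = fps_twist f ^+ k by apply: rmorphXn.
have twM (f g : fps R 1) : fps_twist (f * g) = fps_twist f * fps_twist g.
  exact: rmorphM.
have twD (f g : fps R 1) : fps_twist (f + g) = fps_twist f + fps_twist g.
  exact: rmorphD.
have tw1 : fps_twist (1 : fps R 1) = 1 by apply: rmorph1.
by rewrite twM !twX twD tw1 fps_twistZ fps_twist_var twist_geo scalerN.
Qed.

(** * Alternants and the Vandermonde product *)

Section Alternants.
Context {R : comNzRingType} {n : nat}.
Implicit Types (f : 'I_n -> fps R 1) (m : 'X_{1..n}).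

Definition alternant f : fps R n := \det (\matrix_(i, j) emb i (f j)).

(** The factors involve distinct variables, so a monomial splits among them in at most one way. *)
Lemma fcoef_prod_emb f m (r : seq 'I_n) : uniq r ->
  fcoef (\prod_(i <- r) emb i (f i)) m =
  if [forall i, (i \notin r) ==> (m i == 0%N)] then \prod_(i <- r) ucoef (f i) (m i)
  else 0.
Proof.
elim: r m => [|i r IHr] m /=.
  move=> _; rewrite !big_nil /= -mdeg_eq0 mdegE sum_nat_eq0.
  by rewrite -[RHS](_ : [forall i, m i == 0%N]%:R = _) //; case: ifP.
move=> /andP[i_r uniq_r]; rewrite !big_cons.
pose k := (U_(i) *+ m i)%MM.
have kE j : k j = if j == i then m j else 0%N.
  rewrite mulmnE mnm1E eq_sym; case: eqP => [->|]; rewrite ?mul1n ?mul0n //.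
have le_km : (k <= m)%MM by apply/mnm_lepP => j; rewrite kE; case: eqP.
rewrite (fcoefM_only le_km).
  rewrite (emb_axis _ (erefl k)) IHr //.
  case: ifP => [/forallP m0|/forallPn[j]].
    have -> : [forall j, (j \notin i :: r) ==> (m j == 0%N)].
      apply/forallP => j; rewrite in_cons negb_or; apply/implyP => /andP[ji jr].
      by have := m0 j; rewrite jr mnmBE kE (negPf ji) subn0.
    congr (_ * _); apply: eq_big_seq => j jr; rewrite mnmBE kE.
    by case: (eqVneq j i) jr => [->|]; rewrite ?(negPf i_r) ?subn0.
  rewrite negb_imply mnmBE kE => /andP[jr mj].
  case: ifP => [/forallP/(_ j)|_]; last by rewrite mulr0.
  move: mj; rewrite in_cons (negPf jr) orbF.
  by case: (eqVneq j i) => _; rewrite ?subnn // subn0 => /negPf->.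
move=> l le_lm neq_lk.
have [def_l|l_off] := eqVneq (l : 'X_{1..n}) (U_(i) *+ l i)%MM; last first.
  by rewrite emb_off ?mul0r.
rewrite IHr //; case: ifP => [/forallP/(_ i)|]; last by rewrite mulr0.
rewrite i_r mnmBE subn_eq0 /= => le_ml; case/eqP: neq_lk.
rewrite def_l /k; congr (_ *+ _)%MM; apply/eqP; rewrite eqn_leq le_ml andbT.
by move/mnm_lepP/(_ i): le_lm.
Qed.

(** Row i involves only the variable x_i, so coefficients can be extracted row by row. *)
Lemma fcoef_alternant f m :
  fcoef (alternant f) m = \det (\matrix_(i, j) ucoef (f j) (m i)).
Proof.
rewrite /alternant /determinant fcoef_sum; apply: eq_bigr => s _.
rewrite fcoef_signM; congr (_ * _).
under eq_bigr do rewrite mxE; under [RHS]eq_bigr do rewrite mxE.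
rewrite fcoef_prod_emb ?index_enum_uniq //; case: ifP => // /forallPn[i].
by rewrite mem_index_enum.
Qed.

Lemma alternant_perm (s : 'S_n) f :
  fps_perm s (alternant f) = (-1) ^+ s * alternant f.
Proof.
apply: fpsP => m; rewrite fcoef_signM /= -/(fcoef (alternant f) _) !fcoef_alternant.
rewrite -det_perm -det_mulmx -row_permE; congr (\det _).
by apply/matrixP => i j; rewrite !mxE mnmE.
Qed.

Lemma alternantXM f :
  alternant (fun j => uX * f j) = (\prod_i fps_var i) * alternant f.
Proof.
rewrite /alternant -[\prod_i _](_ : \det (diag_mx (\row_i fps_var i)) = _).
  rewrite -det_mulmx; congr (\det _); apply/matrixP => i j.
  by rewrite mul_diag_mx !mxE rmorphM /= embX.
by rewrite det_diag; apply: eq_bigr => i _; rewrite mxE.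
Qed.

End Alternants.

Lemma det_perm2 (R : comNzRingType) n (s : 'S_n) (A : 'M[R]_n) :
  \det (\matrix_(i, j) A (s i) (s j)) = \det A.
Proof.
have -> : \matrix_(i, j) A (s i) (s j) = row_perm s (col_perm s A).
  by apply/matrixP => i j; rewrite !mxE.
rewrite row_permE col_permE !det_mulmx !det_perm odd_permV mulrC -mulrA.
by rewrite -signr_addb addbb mulr1.
Qed.

(** Reversing rows and columns together costs no sign and passes from decreasing to increasing
    exponents. *)
Lemma vandermondeE (R : comNzRingType) n :
  vandermonde n = alternant (fun j : 'I_n => uX ^+ (n - j.+1)) :> fps R n.
Proof.
pose a : 'rV[fps R n]_n := \row_j fps_var (rev_ord j).
have -> : alternant (fun j : 'I_n => uX ^+ (n - j.+1)) = \det (Vandermonde n a).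
  rewrite -det_tr -(det_perm2 (perm rev_ord_inj)); congr (\det _).
  by apply/matrixP => i j; rewrite !mxE !permE rmorphXn /= embX rev_ordK.
rewrite det_Vandermonde (reindex_inj rev_ord_inj) /=.
under [RHS]eq_bigr => i _ do rewrite (reindex_inj rev_ord_inj) /=.
rewrite /vandermonde (exchange_big_dep predT) //=; apply: eq_bigr => i _.
apply: eq_big => [j|j _]; last by rewrite !mxE !rev_ordK.
by apply/idP/idP => /=; move: (ltn_ord i) (ltn_ord j); lia.
Qed.

Section Stability.
Context {R : comNzRingType} {n : nat}.
Implicit Types f : 'I_n.+1 -> fps R 1.

Lemma ord_max_or_widen (i : 'I_n.+1) :
  i = ord_max \/ exists j : 'I_n, i = widen_ord (leqnSn n) j.
Proof.
have [lt_in|le_ni] := ltnP i n; [right|left].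
  by exists (Ordinal lt_in); apply: val_inj.
by apply/val_inj/eqP; rewrite eqn_leq le_ni -ltnS ltn_ord.
Qed.

Lemma lift_max_widen (i : 'I_n) : lift ord_max i = widen_ord (leqnSn n) i.
Proof. by apply: val_inj; rewrite /= /bump leqNgt ltn_ord. Qed.

(** When the last variable is 0, the last row is (0, ..., 0, 1); expand along it. *)
Lemma res_alternant f : (forall j, ucoef (f j) 0 = (j == ord_max)%:R) ->
  fps_res (alternant f) = alternant (fun j => f (widen_ord (leqnSn n) j)).
Proof.
move=> f0; apply: fpsP => m.
rewrite /= -/(fcoef (alternant f) _) !fcoef_alternant.
rewrite (expand_det_row _ ord_max) (bigD1 ord_max) //= big1 ?addr0.
  rewrite !mxE mnmwiden_ordmax f0 eqxx mul1r /cofactor -signr_odd oddD addbb mul1r.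
  congr (\det _); apply/matrixP => i j.
  by rewrite !mxE !lift_max_widen mnmwiden_widen.
by move=> j j_max; rewrite !mxE mnmwiden_ordmax f0 (negPf j_max) mul0r.
Qed.

Lemma res_vandermonde :
  fps_res (vandermonde n.+1 : fps R n.+1) = (\prod_i fps_var i) * vandermonde n.
Proof.
rewrite !vandermondeE res_alternant => [|j].
  rewrite -alternantXM; congr alternant; apply/funext => j /=.
  by rewrite -exprS -subSn // (ltn_ord j).
rewrite -[uX ^+ _]mulr1 ucoefXnM ucoef1 sub0n eqxx -(inj_eq val_inj) leqn0.
have -> : (n.+1 - j.+1 == 0)%N = (val j == val (@ord_max n)).
  by move: (ltn_ord j) => /=; lia.
by case: eqP.
Qed.

End Stability.

Lemma sum_gt_ord n i : (\sum_(j < n | i < j) 1 = n - i.+1)%N.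
Proof.
elim: n => [|n IHn]; first by rewrite big_ord0 sub0n.
by rewrite big_mkcond big_ord_recr -big_mkcond IHn /=; case: ltnP; lia.
Qed.

(** * Regularity of the Vandermonde product *)

Section Regularity.
Context {R : comNzRingType} {n : nat}.
Implicit Types (f g h : fps R n) (m : 'X_{1..n}).

(* For g homogeneous of degree e: g is regular, one degree at a time.        *)
Definition regular_deg g e := forall f d,
  (forall m, mdeg m = (e + d)%N -> fcoef (g * f) m = 0) ->
  forall m, mdeg m = d -> fcoef f m = 0.

Lemma regular_deg1 : regular_deg 1 0.
Proof. by move=> f d f0 m /f0; rewrite mul1r. Qed.

Lemma regular_degM g h e e' :
  regular_deg g e -> regular_deg h e' -> regular_deg (g * h) (e + e').
Proof.
move=> reg_g reg_h f d f0; apply: reg_h; apply: reg_g => m deg_m.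
by rewrite mulrA f0 // deg_m addnA.
Qed.

Lemma regular_deg_prod (I : Type) (r : seq I) (P : pred I) F e :
    (forall i, P i -> regular_deg (F i) (e i)) ->
  regular_deg (\prod_(i <- r | P i) F i) (\sum_(i <- r | P i) e i).
Proof.
move=> reg_F; apply: (big_rec2 regular_deg); first exact: regular_deg1.
by move=> i e' g Pi reg_g; apply: regular_degM => //; exact: reg_F.
Qed.

Lemma regular_deg_var i : regular_deg (fps_var i) 1.
Proof.
move=> f d f0 m deg_m; have := f0 (U_(i) + m)%MM.
rewrite mdegD mdeg1 deg_m => /(_ erefl).
by rewrite fcoef_varM mnmDE mnm1E eqxx addmC addmK.
Qed.

(** The coefficient of x_i m in (x_i - x_j) f is f_m minus the coefficient of f at x_i m / x_j,
    which has a smaller exponent of x_j (or is absent); induct on that exponent. *)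
Lemma regular_deg_subvar i j : i != j -> regular_deg (fps_var i - fps_var j) 1.
Proof.
move=> neq_ij f d f0 m; have [k] := ubnP (m j).
elim: k m => // k IHk m lt_mj deg_m; have := f0 (U_(i) + m)%MM.
rewrite mdegD mdeg1 deg_m mulrBl => /(_ erefl).
rewrite -[fcoef (_ - _) _]/(fcoef _ _ - fcoef _ _).
rewrite !fcoef_varM !mnmDE !mnm1E eqxx (negPf neq_ij) add0n /=.
rewrite [(U_(i) + m)%MM]addmC addmK; case: eqP => [_|/eqP mj].
  by rewrite subr0.
rewrite (IHk (m + U_(i) - U_(j))%MM) ?subr0 //.
  by rewrite mnmBE mnmDE !mnm1E eqxx (negPf neq_ij) addn0; lia.
have le_j : (U_(j) <= m + U_(i))%MM.
  by rewrite lep1mP mnmDE mnm1E (negPf neq_ij) addn0.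
have : mdeg (m + U_(i) - U_(j) + U_(j))%MM = d.+1.
  by rewrite (submK le_j) mdegD mdeg1 deg_m addn1.
by rewrite mdegD mdeg1 addn1 => -[].
Qed.

Lemma regular_deg_inj g e f h : regular_deg g e -> g * f = g * h -> f = h.
Proof.
move=> reg_g eq_gf; apply: fpsP => m; apply/eqP; rewrite -subr_eq0; apply/eqP.
rewrite -[LHS]/(fcoef (f - h) m); apply: (reg_g _ (mdeg m)) => // k _.
by rewrite mulrBr eq_gf subrr.
Qed.

Lemma regular_deg_vandermonde :
  regular_deg (vandermonde n : fps R n) (\sum_(i < n) (n - i.+1)).
Proof.
under eq_bigr do rewrite -sum_gt_ord.
apply: regular_deg_prod => i _; apply: regular_deg_prod => j lt_ij.
by apply: regular_deg_subvar; rewrite neq_ltn lt_ij.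
Qed.

Definition vandermonde_inj f h := @regular_deg_inj _ _ f h regular_deg_vandermonde.

Lemma fps_quotE f g h : (forall k, g * k = g * h -> k = h) -> h * g = f ->
  fps_quot f g = h.
Proof.
move=> g_inj def_f; rewrite /fps_quot; case: pselect => [ex|[]]; last by exists h.
by case: (cid ex) => k /= def_k; apply: g_inj; rewrite mulrC def_k -def_f mulrC.
Qed.

End Regularity.

(** * Partitions *)

Fact geq_trans : transitive geq.
Proof. by move=> a b c ab bc; apply: leq_trans bc ab. Qed.

Section Partitions.
Implicit Types (la mu : intpart) (s : seq nat).

Lemma part_sorted la : sorted geq la.
Proof. by case: la => s p /=; case/andP: p. Qed.

Lemma part_mono la i j : (i <= j)%N -> (nth 0 la j <= nth 0 la i)%N.
Proof.
move=> le_ij; have [lt_j|le_j] := ltnP j (size la); last by rewrite nth_default.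
apply: (sorted_leq_nth geq_trans (@leqnn) 0%N (part_sorted la) _ _ _ _ le_ij) => //.
by rewrite inE (leq_ltn_trans le_ij).
Qed.

Lemma nth_part_gt0 la i : (0 < nth 0 la i)%N = (i < size la)%N.
Proof.
have [lt_i|le_i] := ltnP i (size la); last by rewrite nth_default.
case: la lt_i => s p /= lt_i; case/andP: p => _ s0; rewrite lt0n.
by apply: contraNneq s0 => <-; rewrite mem_nth.
Qed.

Lemma partP la mu : (forall i, nth 0 la i = nth 0 mu i)%N -> la = mu.
Proof.
move=> eq_nth; apply: val_inj; apply: (@eq_from_nth _ 0%N) => //=.
have eq_lt i : (i < size la)%N = (i < size mu)%N by rewrite -!nth_part_gt0 eq_nth.
apply/eqP; rewrite eqn_leq.
have := eq_lt (size mu); have := eq_lt (size la).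
by rewrite !ltnn; do 2!case: ltnP.
Qed.

Lemma part_sizeE la n : (size la <= n)%N -> part_size la = (\sum_(i < n) nth 0 la i)%N.
Proof.
move=> le_n; rewrite /part_size sumnE (big_nth 0%N) big_mkord.
rewrite (big_ord_widen_cond n (fun=> true) (fun i => nth 0%N la i) le_n) big_mkcond /=.
by apply: eq_bigr => i _; case: ltnP => // /(nth_default 0%N).
Qed.

(** In a weakly decreasing list the entries greater than k form a prefix. *)
Lemma ltn_count_sorted s j k : sorted geq s ->
  (j < count (fun p => k < p) s)%N = (k < nth 0 s j)%N.
Proof.
elim: s j => [|x s IHs] j /= sorted_s; first by rewrite nth_nil !ltn0.
have {}IHs := IHs _ (path_sorted sorted_s).
case: (ltnP k x) => [lt_kx|le_xk]; first by case: j => [|j] //=; rewrite -IHs.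
have /allP x_max := order_path_min geq_trans sorted_s.
have -> : count (fun p => k < p)%N s = 0%N.
  apply/eqP; rewrite -leqn0 leqNgt -has_count; apply/hasPn => y /x_max /= le_y.
  by rewrite -leqNgt (leq_trans le_y).
case: j => [|j] /=; first by rewrite [RHS]ltnNge le_xk.
have [lt_j|le_j] := ltnP j (size s); last by rewrite nth_default.
have /x_max /= le_y := mem_nth 0%N lt_j.
by apply/esym/negbTE; rewrite -leqNgt (leq_trans le_y).
Qed.

Lemma nth_conj la k : nth 0%N (conj_part la) k = count (fun p => k < p)%N la.
Proof.
rewrite /conj_part /= /conj_seq; case: (ltnP k (head 0 la)%N) => [lt_k|le_k].
  by rewrite nth_mkseq.
rewrite nth_default ?size_mkseq //; apply/esym/eqP; rewrite -leqn0 leqNgt.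
by rewrite ltn_count_sorted ?part_sorted // nth0 -leqNgt.
Qed.

(** Both sides say that the box in row j and column k lies in the diagram. *)
Lemma ltn_conj la j k : (j < nth 0 (conj_part la) k)%N = (k < nth 0 la j)%N.
Proof. by rewrite nth_conj ltn_count_sorted ?part_sorted. Qed.

Lemma conj_partK : involutive conj_part.
Proof.
move=> la; apply: partP => i.
have eq_lt j : (j < nth 0 (conj_part (conj_part la)) i)%N = (j < nth 0 la i)%N.
  by rewrite !ltn_conj.
have := eq_lt (nth 0 la i)%N; have := eq_lt (nth 0 (conj_part (conj_part la)) i)%N.
by rewrite !ltnn; lia.
Qed.

Fact part_of_subproof s :
  is_partition [seq x <- sort geq s | x != 0%N].
Proof.
rewrite /is_partition mem_filter eqxx andbT sorted_filter //.
  exact: geq_trans.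
by apply: sort_sorted => a b /=; rewrite leq_total.
Qed.

(** Sorting only makes the definition total: its values are computed for sorted lists
    ([nth_part_of]). *)
Definition part_of s : intpart := IntPart (part_of_subproof s).

Lemma nth_filter_sorted s i : sorted geq s ->
  nth 0%N [seq x <- s | x != 0%N] i = nth 0%N s i.
Proof.
elim: s i => //= x s IHs i sorted_s.
case: eqP => [x0|_]; last by case: i => //= i; apply/IHs/path_sorted/sorted_s.
have /allP s0 := order_path_min geq_trans sorted_s.
have nth0s j : nth 0%N s j = 0%N.
  have [lt_j|le_j] := ltnP j (size s); last by rewrite nth_default.
  by have /s0 := mem_nth 0%N lt_j; rewrite x0 /= leqn0 => /eqP.
rewrite IHs ?(path_sorted sorted_s) // nth0s; by case: i => [|i] /=.
Qed.

Lemma nth_part_of s i : sorted geq s -> nth 0%N (part_of s) i = nth 0%N s i.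
Proof.
move=> sorted_s; rewrite /= sorted_sort ?nth_filter_sorted //.
exact: geq_trans.
Qed.

End Partitions.

(** * Restrictions of the Grothendieck functions *)

(** Reducing p_j modulo the product of the X - x_i keeps its values at the x_i and makes its degree
    less than n; the matrix then factors as a Vandermonde matrix times a coefficient matrix. *)
Lemma det_horner_dvd (A : comNzRingType) n (x : 'I_n -> A) (p : 'I_n -> {poly A}) :
  exists h, \det (\matrix_(i, j) (p j).[x i]) = h * \det (\matrix_(i, j < n) x i ^+ j).
Proof.
pose d := \prod_(i < n) ('X - (x i)%:P).
have mon_d : d \is monic by apply: monic_prod_XsubC.
have size_d : size d = n.+1.
  by rewrite /d -(big_map x predT (fun a => 'X - a%:P)) size_prod_XsubC size_map
    [index_enum _]unlock -enumT size_enum_ord.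
exists (\det (\matrix_(k < n, j < n) (Pdiv.Ring.rmodp (p j) d)`_k)).
rewrite mulrC -det_mulmx; congr (\det _); apply/matrixP => i j; rewrite !mxE.
have d0 : d.[x i] = 0.
  by rewrite /d (bigD1 i) //= hornerM !hornerE subrr mul0r.
rewrite [in LHS](Pdiv.RingMonic.rdivp_eq mon_d (p j)) hornerD hornerM d0 mulr0 add0r.
rewrite (@horner_coef_wide _ n); last first.
  by rewrite -ltnS -size_d Pdiv.Ring.ltn_rmodpN0 ?monic_neq0.
by apply: eq_bigr => k _; rewrite !mxE mulrC.
Qed.

Lemma ucoef0M (R : comNzRingType) (f g : fps R 1) :
  ucoef (f * g) 0 = ucoef f 0 * ucoef g 0.
Proof. by rewrite ucoefM big_ord_recl big_ord0 addr0. Qed.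

Section Numerators.
Context {R : comNzRingType} (a b : R) (la : intpart).

Definition gcol n (j : 'I_n) : fps R 1 :=
  uX ^+ (nth 0%N la j + (n - j.+1)) * (1 + b *: uX) ^+ j * geo a ^+ nth 0%N la j.

Lemma gcol_dvd n : exists h, h * vandermonde n = alternant (@gcol n).
Proof.
(* K is the largest part, so multiplying each row i by (1 - a x_i)^K clears all denominators. *)
pose K := nth 0%N la 0.
pose p (j : 'I_n) : {poly fps R n} := 'X ^+ (nth 0%N la j + (n - j.+1))
  * (1 + (b *: 1)%:P * 'X) ^+ j * (1 - (a *: 1)%:P * 'X) ^+ (K - nth 0%N la j).
have [h def_h] := det_horner_dvd (fun i => fps_var i) p.
have [h' def_h'] : exists h', \det (\matrix_(i, j < n) fps_var i ^+ j)
    = h' * vandermonde n :> fps R n.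
  pose e : fps R n := \prod_(i < n) \prod_(j < n | (i < j)%N) -1.
  exists e; rewrite -det_tr /vandermonde -big_split /=.
  transitivity (\det (Vandermonde n (\row_(j < n) fps_var j : 'rV[fps R n]_n))).
    by congr (\det _); apply/matrixP => i j; rewrite !mxE.
  rewrite det_Vandermonde; apply: eq_bigr => i _; rewrite -big_split /=.
  by apply: eq_bigr => j _; rewrite !mxE mulN1r opprB.
exists ((\prod_i emb i (geo a ^+ K)) * h * h'); rewrite -!mulrA -def_h' -def_h.
rewrite -[\prod_i _](_ : \det (diag_mx (\row_i emb i (geo a ^+ K))) = _).
  rewrite -det_mulmx; congr (\det _); apply/matrixP => i j.
  rewrite mul_diag_mx !mxE /p !hornerE /= -embX -!(rmorph1 (emb i)) -!embZ.
  rewrite -!rmorphM -!rmorphXn -!(rmorphD, rmorphB, rmorphM, rmorphXn) /=.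
  congr (emb i _); rewrite /gcol !mulr_algl.
  have {1}<- : (nth 0%N la j + (K - nth 0%N la j) = K)%N by rewrite subnKC // part_mono.
  set l := nth 0%N la j; set e := (1 + _); set e' := (1 - _); rewrite exprD -[RHS]mulr1.
  have <- : geo a ^+ (K - l) * e' ^+ (K - l) = 1 by rewrite -exprMn geoV expr1n.
  by ring.
by rewrite det_diag; apply: eq_bigr => i _; rewrite mxE.
Qed.

Lemma emb_gcol n (i j : 'I_n) :
  emb i (gcol j) = fps_var i ^+ (nth 0%N la j + (n - j.+1)) * (1 + b *: fps_var i) ^+ j
    * emb i (geo a) ^+ nth 0%N la j.
Proof. by rewrite /gcol !rmorphM !rmorphXn !rmorphD !rmorph1 /= embZ embX. Qed.

Lemma fps_quot_gcol n (i j : 'I_n) :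
  fps_quot (fps_var i ^+ (nth 0%N la j + (n - j.+1)) * (1 + b *: fps_var i) ^+ j)
    ((1 - a *: fps_var i) ^+ nth 0%N la j) = emb i (gcol j).
Proof.
have geo_i : emb i (geo a) * (1 - a *: fps_var i) = 1.
  by rewrite -embX -embZ -(rmorph1 (emb i)) -rmorphB -rmorphM geoV.
apply: fps_quotE.
  move=> k eq_kh; rewrite -[LHS]mul1r -[RHS]mul1r -(expr1n _ (nth 0%N la j)) -geo_i.
  by rewrite exprMn -!mulrA eq_kh.
by rewrite emb_gcol -mulrA -exprMn geo_i expr1n mulr1.
Qed.

Lemma ucoef0_unit j l : ucoef ((1 + b *: uX) ^+ j * geo a ^+ l) 0 = 1.
Proof.
have ucoef0X (f : fps R 1) k : ucoef f 0 = 1 -> ucoef (f ^+ k) 0 = 1.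
  move=> f0; elim: k => [|k IHk]; first by rewrite ucoef1.
  by rewrite exprS ucoef0M f0 IHk mulr1.
rewrite ucoef0M !ucoef0X ?mulr1 ?ucoef_geo ?expr0 //.
rewrite -[LHS]/(ucoef 1 0 + b * ucoef uX 0) ucoef1 -[uX]mulr1 ucoefXM.
by rewrite mulr0 addr0.
Qed.

Lemma ucoef_gcol n (j : 'I_n) k : (k <= nth 0 la j + (n - j.+1))%N ->
  ucoef (gcol j) k = (k == nth 0 la j + (n - j.+1))%N%:R.
Proof.
move=> le_k; rewrite /gcol -mulrA ucoefXnM eqn_leq le_k /=.
have [le_d|//] := leqP.
have -> : (k - (nth 0 la j + (n - j.+1)) = 0)%N by apply/eqP; rewrite subn_eq0.
exact: ucoef0_unit.
Qed.

Lemma gcol_widen n (j : 'I_n) : gcol (widen_ord (leqnSn n) j) = uX * gcol j.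
Proof.
rewrite /gcol /= subSS mulrA; congr (_ * _); rewrite mulrA; congr (_ * _).
by rewrite -exprS -addnS -subnSK.
Qed.

(** Since la has at most n parts, the last of the n + 1 columns has constant term 1 and all others
    have constant term 0. *)
Lemma res_gcol n : (size la <= n)%N ->
  fps_res (alternant (@gcol n.+1)) = (\prod_i fps_var i) * alternant (@gcol n).
Proof.
move=> le_n; rewrite res_alternant => [|j].
  by rewrite -alternantXM; congr alternant; apply/funext => j; apply: gcol_widen.
rewrite ucoef_gcol // eq_sym addn_eq0 subn_eq0 ltnS; congr (nat_of_bool _)%:R.
rewrite -(inj_eq val_inj) /=; have := ltn_ord j.
have [le_nj|] := leqP n j; last by lia.
by rewrite nth_default ?(leq_trans le_n) //; lia.
Qed.

End Numerators.

Section FromAlternants.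
Context {R : comNzRingType}.

Lemma widen_perm n (s : 'S_n) (m : 'X_{1..n}) :
  mnmwiden [multinom m (s i) | i < n] =
  [multinom mnmwiden m (lift_perm ord_max ord_max s i) | i < n.+1].
Proof.
apply/mnmP => i; rewrite mnmE; case: (ord_max_or_widen i) => [->|[j ->]].
  by rewrite lift_perm_id !mnmwiden_ordmax.
by rewrite mnmwiden_widen mnmE -lift_max_widen lift_perm_lift lift_max_widen mnmwiden_widen.
Qed.

(** Levels below N are recovered by setting variables to 0, one level per induction step; a
    permutation at the new level is extended by fixing the last variable. *)
Lemma symfun_extend N (F : forall n, fps R n) :
    (forall n, (N <= n)%N -> forall s, fps_perm s (F n) = F n) ->
    (forall n, (N <= n)%N -> fps_res (F n.+1) = F n) ->
  exists f : symfun R, forall n, (N <= n)%N -> restr f n = F n.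
Proof.
elim: N F => [|N IHN] F F_sym F_res.
  have F_sym' n (s : 'S_n) (m : 'X_{1..n}) :
    fcoef (F n) [multinom m (s i) | i < n] = fcoef (F n) m by rewrite -{2}(F_sym n _ s).
  have F_res' n (m : 'X_{1..n}) : fcoef (F n.+1) (mnmwiden m) = fcoef (F n) m.
    by rewrite -[in RHS](F_res n).
  by exists (SymFun F_sym' F_res').
pose F' n := if n == N then fps_res (F n.+1) else F n.
have [n le_Nn s|n le_Nn|f f_F'] := IHN F'; last 1 first.
- by exists f => n lt_Nn; rewrite f_F' ?(ltnW lt_Nn) // /F' gtn_eqF.
- rewrite /F'; case: (eqVneq n N) s => [-> s|neq_n s]; last first.
    by rewrite F_sym // ltn_neqAle eq_sym neq_n.
  apply: fpsP => m /=; rewrite widen_perm.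
  by rewrite -{2}(F_sym N.+1 (leqnn _) (lift_perm ord_max ord_max s)).
rewrite /F'; case: (eqVneq n N) => [->|neq_n]; first by rewrite gtn_eqF.
by rewrite gtn_eqF ?ltnS // F_res // ltn_neqAle eq_sym neq_n.
Qed.

Lemma symfun_ofE N (F : forall n, fps R n) :
    (forall n, (N <= n)%N -> forall s, fps_perm s (F n) = F n) ->
    (forall n, (N <= n)%N -> fps_res (F n.+1) = F n) ->
  forall n, (N <= n)%N -> restr (symfun_of N F) n = F n.
Proof.
move=> F_sym F_res; rewrite /symfun_of; case: pselect => [ex|[]].
  by case: (cid ex) => f.
exact: symfun_extend.
Qed.

Lemma restr_res (f : symfun R) n : fps_res (restr f n.+1) = restr f n.
Proof. by apply: fpsP => m /=; rewrite restr_widen. Qed.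

Lemma restr_eq_large N (f g : symfun R) :
  (forall n, (N <= n)%N -> restr f n = restr g n) -> f = g.
Proof.
move=> fg; apply: symfunP => n; have [k] := ubnP (N - n)%N.
elim: k n => // k IHk n lt_k; have [/fg//|lt_nN] := leqP N n.
by rewrite -(restr_res f) -(restr_res g) IHk //; lia.
Qed.

Lemma prod_var_inj n (f g : fps R n) :
  (\prod_i fps_var i) * f = (\prod_i fps_var i) * g -> f = g.
Proof.
apply: (@regular_deg_inj _ _ _ (\sum_(i < n) 1)).
by apply: regular_deg_prod => i _; apply: regular_deg_var.
Qed.

Variables (a b : R) (la : intpart).

(** The quotient exists by [gcol_dvd]; since V is regular, it inherits symmetry and stability from
    the alternants, so [symfun_of] returns it. *)
Theorem restr_grothendieck n : (size la <= n)%N ->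
  vandermonde n * restr (grothendieck a b la) n = alternant (@gcol R a b la n).
Proof.
move=> le_n; rewrite /grothendieck.
under [F in symfun_of _ F]functional_extensionality_dep => k.
  under [M in \det M]eq_mx => i j do rewrite fps_quot_gcol.
  rewrite -/(alternant _).
  over.
pose Q k := fps_quot (alternant (@gcol R a b la k)) (vandermonde k).
have Q_V k : vandermonde k * Q k = alternant (@gcol R a b la k).
  have [h def_h] := gcol_dvd a b la k.
  by rewrite /Q (fps_quotE (fun k0 => @vandermonde_inj _ _ k0 h) def_h) mulrC.
rewrite (symfun_ofE (F := Q)) ?Q_V // => [k _ s|k le_k].
  apply: vandermonde_inj; rewrite Q_V.
  have := congr1 (fps_perm s) (Q_V k).
  rewrite rmorphM /= vandermondeE !alternant_perm -vandermondeE -mulrA.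
  exact/(can_inj (signrMK _)).
apply: vandermonde_inj; apply: prod_var_inj; rewrite Q_V -res_gcol // -Q_V.
by rewrite mulrA -res_vandermonde rmorphM.
Qed.

End FromAlternants.

Lemma schurE (R : comNzRingType) la : schur la = grothendieck 0 0 la :> symfun R.
Proof.
rewrite /schur /grothendieck; congr symfun_of; apply/functional_extensionality_dep => n.
congr (fps_quot (\det _) _); apply/matrixP => i j; rewrite !mxE fps_quot_gcol.
by rewrite /gcol scale0r addr0 expr1n mulr1 geo0 expr1n mulr1 rmorphXn /= embX.
Qed.

(** * Schur expansions *)

(** Both s and its inverse are increasing, and an increasing permutation moves no index down. *)
Lemma dec_perm_id n (u v : 'I_n -> nat) (s : 'S_n) :
    (forall i j : 'I_n, (i < j)%N -> (u j < u i)%N) ->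
    (forall i j : 'I_n, (i < j)%N -> (v j < v i)%N) ->
  (forall i, u i = v (s i)) -> s = 1%g.
Proof.
move=> u_dec v_dec uv.
have incr_id (t : 'S_n) : (forall i j : 'I_n, (i < j)%N -> (t i < t j)%N) ->
    forall i : 'I_n, (i <= t i)%N.
  move=> t_incr [k lt_k]; elim: k lt_k => [|k IHk] lt_k //=.
  have lt_k' := ltnW lt_k; apply: leq_ltn_trans (IHk lt_k') _.
  by apply: t_incr => /=.
have s_incr (i j : 'I_n) : (i < j)%N -> (s i < s j)%N.
  move=> /u_dec; rewrite !uv; case: (ltngtP (s i) (s j)) => // [/v_dec|/val_inj->].
    by lia.
  by rewrite ltnn.
have sV_incr (i j : 'I_n) : (i < j)%N -> (s^-1%g i < s^-1%g j)%N.
  rewrite -{1}(permKV s i) -{1}(permKV s j).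
  case: (ltngtP (s^-1%g i) (s^-1%g j)) => // [/s_incr|/val_inj->]; first by lia.
  by rewrite ltnn.
apply/permP => i; rewrite perm1; apply/val_inj/eqP; rewrite eqn_leq.
rewrite incr_id // andbT; have := incr_id _ sV_incr (s i).
by rewrite permK.
Qed.

Lemma det_dec (R : comNzRingType) n (u v : 'I_n -> nat) (A : 'M[R]_n) :
    (forall i j : 'I_n, (i < j)%N -> (u j < u i)%N) ->
    (forall i j : 'I_n, (i < j)%N -> (v j < v i)%N) ->
    (forall i j, u i = v j -> A i j = 1) ->
    (forall s : 'S_n, (forall i, A i (s i) != 0) -> forall i, u i = v (s i)) ->
  \det A = [forall i, u i == v i]%:R.
Proof.
move=> u_dec v_dec A1 A0.
have A_s (s : 'S_n) : s != 1%g -> \prod_i A i (s i) = 0.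
  move=> s_neq1; have [/forallP nz|/forallPn[i]] := boolP [forall i, A i (s i) != 0].
    by case/eqP: s_neq1; apply: dec_perm_id (A0 s nz).
  by rewrite negbK => /eqP Ai0; rewrite (bigD1 i) //= Ai0 mul0r.
rewrite /determinant (bigD1 (1%g : 'S_n)) //= [X in _ + X]big1 => [|s /A_s->]; last first.
  by rewrite mulr0.
rewrite addr0 odd_perm1 mul1r; case: forallP => [uv|uv].
  by rewrite big1 // => i _; rewrite perm1 A1 //; apply/eqP.
have [/forallP nz|/forallPn[i]] := boolP [forall i, A i ((1%g : 'S_n) i) != 0].
  by case: uv => i; rewrite (A0 1%g nz) perm1.
by rewrite negbK => /eqP Ai0; rewrite (bigD1 i) //= Ai0 mul0r.
Qed.

Section SchurCoefficients.
Context {R : comNzRingType}.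
Implicit Types (f g : symfun R) (la mu nu : intpart).

Definition stair n nu : 'X_{1..n} := [multinom (nth 0 nu i + (n - i.+1))%N | i < n].

(* The coefficient of s_nu in f, read off the leading term x^(nu + delta) of *)
(* the alternant V s_nu.                                                     *)
Definition schur_coef f nu : R :=
  fcoef (vandermonde (size nu) * restr f (size nu)) (stair (size nu) nu).

Lemma fcoef_prodvarM n (h : fps R n) (r : seq 'I_n) m :
  fcoef ((\prod_(i <- r) fps_var i) * h) (\sum_(i <- r) U_(i) + m)%MM = fcoef h m.
Proof.
elim: r => [|i r IHr]; first by rewrite !big_nil mul1r add0m.
rewrite !big_cons -mulrA fcoef_varM -addmA mnmDE mnm1E eqxx /= addmC addmK.
exact: IHr.
Qed.

Lemma stair_widen n nu : (size nu <= n)%N ->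
  stair n.+1 nu = mnmwiden (\sum_(i < n) U_(i) + stair n nu)%MM.
Proof.
move=> le_n; apply/mnmP => i; rewrite mnmE.
case: (ord_max_or_widen i) => [->|[j ->]].
  by rewrite mnmwiden_ordmax /= nth_default // subnn.
rewrite mnmwiden_widen mnmDE mnm_sumE mnmE (bigD1 j) //= mnm1E eqxx big1 => [|k].
  by have := ltn_ord j; lia.
by move=> neq_k; rewrite mnm1E (negPf neq_k).
Qed.

(** Passing from n + 1 to n variables takes V to the product of the variables times V, and shifts
    the staircase by the same monomial. *)
Lemma schur_coefE n f nu : (size nu <= n)%N ->
  fcoef (vandermonde n * restr f n) (stair n nu) = schur_coef f nu.
Proof.
move=> /subnK <-; elim: (n - size nu)%N => [|k IHk] //.
rewrite addSn stair_widen ?leq_addl //.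
rewrite -[LHS]/(fcoef (fps_res (vandermonde _ * restr f _)) _).
by rewrite fps_resM res_vandermonde restr_res -mulrA fcoef_prodvarM.
Qed.

Lemma restrB f g n : restr (f - g) n = restr f n - restr g n.
Proof. by []. Qed.

Lemma restr_sum (I : Type) (r : seq I) (F : I -> symfun R) n :
  restr (\sum_(i <- r) F i) n = \sum_(i <- r) restr (F i) n.
Proof. by apply: (big_morph (fun f => restr f n)). Qed.

Lemma schur_coefB f g nu : schur_coef (f - g) nu = schur_coef f nu - schur_coef g nu.
Proof. by rewrite /schur_coef restrB mulrBr. Qed.

Lemma schur_coefZ a f nu : schur_coef (a *: f) nu = a * schur_coef f nu.
Proof.
rewrite /schur_coef -[restr _ _]/(a *: restr f _) mulrC -scalerAl.
by rewrite -[LHS]/(a * fcoef _ _) mulrC [_ * restr _ _]mulrC mulrC.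
Qed.

Lemma schur_coef_sum (I : Type) (r : seq I) (F : I -> symfun R) nu :
  schur_coef (\sum_(i <- r) F i) nu = \sum_(i <- r) schur_coef (F i) nu.
Proof. by rewrite /schur_coef restr_sum mulr_sumr fcoef_sum. Qed.

Lemma schur_coef_grothendieck n a b la nu : (size la <= n)%N -> (size nu <= n)%N ->
  schur_coef (grothendieck a b la) nu =
  \det (\matrix_(i < n, j < n) ucoef (gcol a b la j) (nth 0 nu i + (n - i.+1))%N).
Proof.
move=> le_la le_nu; rewrite -(schur_coefE _ le_nu) restr_grothendieck //.
by rewrite fcoef_alternant; congr (\det _); apply/matrixP => i j; rewrite !mxE mnmE.
Qed.

Lemma stair_dec n nu (i j : 'I_n) : (i < j)%N ->
  (nth 0 nu j + (n - j.+1) < nth 0 nu i + (n - i.+1))%N.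
Proof.
move=> lt_ij; have := part_mono nu (ltnW lt_ij); have := ltn_ord j; lia.
Qed.

Lemma eq_stair n la nu : (size la <= n)%N -> (size nu <= n)%N ->
  [forall i : 'I_n, nth 0 nu i + (n - i.+1) == nth 0 la i + (n - i.+1)]%N = (nu == la).
Proof.
move=> le_la le_nu; apply/forallP/eqP => [eq_nth|->//]; apply: partP => i.
have [lt_i|le_i] := ltnP i n; last by rewrite !nth_default // (leq_trans _ le_i).
by have := eq_nth (Ordinal lt_i); rewrite eqn_add2r => /eqP.
Qed.

(** Column j starts in degree la_j + n - 1 - j. A nonzero term of the determinant bounds each row
    exponent of nu below by one of la, and comparing the sums forces equality throughout. *)
Lemma schur_coef_grothendieck_le a b la nu : (part_size nu <= part_size la)%N ->
  schur_coef (grothendieck a b la) nu = (nu == la)%:R.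
Proof.
move=> le_size; pose n := maxn (size la) (size nu).
have le_la : (size la <= n)%N by rewrite leq_maxl.
have le_nu : (size nu <= n)%N by rewrite leq_maxr.
rewrite (schur_coef_grothendieck _ _ le_la le_nu) -(eq_stair le_la le_nu).
apply: (@det_dec _ _ (fun i : 'I_n => nth 0 nu i + (n - i.+1))%N
                     (fun i : 'I_n => nth 0 la i + (n - i.+1))%N) => [||i j|s nz].
- exact: stair_dec.
- exact: stair_dec.
- by move=> eq_ij; rewrite mxE eq_ij ucoef_gcol ?eqxx.
pose u (i : 'I_n) := (nth 0 nu i + (n - i.+1))%N.
pose v (i : 'I_n) := (nth 0 la i + (n - i.+1))%N.
have le_vu i : (v (s i) <= u i)%N.
  rewrite leqNgt; apply: contraNN (nz i) => lt_uv.
  by rewrite mxE ucoef_gcol ?(ltnW lt_uv) // ltn_eqF.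
have le_uv : (\sum_i u i <= \sum_i v (s i))%N.
  have <- : (\sum_i v i = \sum_i v (s i))%N by rewrite (reindex_inj (@perm_inj _ s)).
  rewrite !big_split /= leq_add2r.
  by rewrite -!part_sizeE.
move=> i; apply/eqP; rewrite eqn_leq le_vu andbT leqNgt; apply/negP => lt_i.
have : (\sum_i v (s i) < \sum_i u i)%N; last by rewrite ltnNge le_uv.
rewrite (bigD1 i) // [ltnRHS](bigD1 i) //= -addSn leq_add //.
by apply: leq_sum => j _; apply: le_vu.
Qed.

Lemma schur_coef_schur la nu : schur_coef (schur la) nu = (nu == la)%:R.
Proof.
rewrite schurE; pose n := maxn (size la) (size nu).
have le_la : (size la <= n)%N by rewrite leq_maxl.
have le_nu : (size nu <= n)%N by rewrite leq_maxr.
rewrite (schur_coef_grothendieck _ _ le_la le_nu) -(eq_stair le_la le_nu).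
have gcol00 (j : 'I_n) k :
    ucoef (gcol 0 0 la j) k = (k == nth 0 la j + (n - j.+1))%N%:R :> R.
  rewrite /gcol scale0r addr0 expr1n mulr1 geo0 expr1n ucoefXnM ucoef1.
  by rewrite subn_eq0 eqn_leq andbC; case: (_ <= k)%N.
apply: (@det_dec _ _ (fun i : 'I_n => nth 0 nu i + (n - i.+1))%N
                     (fun i : 'I_n => nth 0 la i + (n - i.+1))%N) => [||i j|s nz i].
- exact: stair_dec.
- exact: stair_dec.
- by move=> eq_ij; rewrite mxE gcol00 eq_ij eqxx.
by apply/eqP; apply: contraNT (nz i) => /negPf neq_i; rewrite mxE gcol00 neq_i.
Qed.

End SchurCoefficients.

Lemma sort_exponents n (m : 'X_{1..n}) : injective m ->
  exists s : 'S_n, forall i j : 'I_n, (i < j)%N -> (m (s j) < m (s i))%N.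
Proof.
move=> m_inj; have /tuple_permP[s def_s] : perm_eq (sort geq m) (multinom_val m).
  by rewrite perm_sort.
exists s => i j lt_ij; rewrite ltn_neqAle.
have nth_s k : nth 0%N (sort geq m) (k : 'I_n) = m (s k).
  by rewrite def_s -tnth_nth tnth_mktuple.
apply/andP; split.
  apply: contraTneq lt_ij => /m_inj/perm_inj->; by rewrite ltnn.
rewrite -!nth_s.
apply: (sorted_leq_nth geq_trans (@leqnn) 0%N _ _ _ _ _ (ltnW lt_ij)).
- by apply: sort_sorted => a b; apply: leq_total.
- by rewrite inE size_sort size_tuple.
- by rewrite inE size_sort size_tuple.
Qed.

Lemma stair_of_dec n (m : 'X_{1..n}) :
    (forall i j : 'I_n, (i < j)%N -> (m j < m i)%N) ->
  exists nu : intpart, [/\ (size nu <= n)%N, stair n nu = m &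
     mdeg m = (part_size nu + \sum_(i < n) (n - i.+1))%N].
Proof.
move=> m_dec; pose t := [seq (m i - (n - (i : nat).+1))%N | i <- enum 'I_n].
have m_ge (i : 'I_n) : (n - i.+1 <= m i)%N.
  have [k] := ubnP (n - i.+1)%N; elim: k i => // k IHk i lt_k.
  have [lt_i|] := ltnP i.+1 n; last by lia.
  have := m_dec i (Ordinal lt_i) (ltnSn i); have := IHk (Ordinal lt_i) => /=.
  lia.
have nth_t (i : 'I_n) : nth 0%N t i = (m i - (n - i.+1))%N.
  by rewrite (nth_map i) ?size_enum_ord // nth_ord_enum.
have size_t : size t = n by rewrite size_map size_enum_ord.
have sorted_t : sorted geq t.
  apply/(sortedP 0%N) => i; rewrite size_t => lt_i.
  have := nth_t (Ordinal (ltnW lt_i)); have := nth_t (Ordinal lt_i) => /= -> ->.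
  have := m_dec (Ordinal (ltnW lt_i)) (Ordinal lt_i) (ltnSn i) => /=; lia.
pose nu := part_of t; have nth_nu (i : 'I_n) : nth 0%N nu i = (m i - (n - i.+1))%N.
  by rewrite nth_part_of.
have le_nu : (size nu <= n)%N.
  rewrite leqNgt -(@nth_part_gt0 nu n) nth_part_of // nth_default //.
  by rewrite size_t.
exists nu; split=> //.
  by apply/mnmP => i; rewrite mnmE nth_nu subnK.
rewrite (part_sizeE le_nu) -big_split mdegE; apply: eq_bigr => i _.
by rewrite -[RHS]/(nth 0 nu i + (n - i.+1))%N nth_nu subnK.
Qed.

(** * Existence and uniqueness of Schur expansions *)

Section HasSum.
Context {R : comNzRingType}.
Implicit Types (f g : symfun R) (la mu nu : intpart).
Hypothesis two_reg : forall x : R, x + x = 0 -> x = 0.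

(** Distinct exponents can be sorted to a staircase; a repeated exponent makes the coefficient equal
    to its opposite, hence 0 by [two_reg]. *)
Lemma alternating_eq0 n (g : fps R n) d :
    (forall s : 'S_n, fps_perm s g = (-1) ^+ s * g) ->
    (forall nu, (size nu <= n)%N -> part_size nu = d -> fcoef g (stair n nu) = 0) ->
  forall m, mdeg m = (\sum_(i < n) (n - i.+1) + d)%N -> fcoef g m = 0.
Proof.
move=> g_alt g0 m deg_m.
have g_perm (s : 'S_n) (k : 'X_{1..n}) :
    fcoef g [multinom k (s i) | i < n] = (-1) ^+ s * fcoef g k.
  by rewrite -fcoef_signM -g_alt.
have [/injectiveP m_inj|/injectivePn[i [j neq_ij eq_m]]] := boolP (injectiveb m).
  have [s s_dec] := sort_exponents m_inj.
  have [i j lt_ij|nu [le_nu def_nu deg_nu]] := @stair_of_dec n [multinom m (s i) | i < n].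
    by rewrite !mnmE s_dec.
  rewrite mdeg_mperm deg_m addnC in deg_nu.
  have := g_perm s m; rewrite -def_nu g0 //; last by move/addIn: deg_nu.
  by move=> /esym/(congr1 (fun x => (-1) ^+ s * x)); rewrite signrMK mulr0.
have := g_perm (tperm i j) m.
have -> : [multinom m (tperm i j k) | k < n] = m.
  by apply/mnmP => k; rewrite mnmE; case: tpermP => [->|->|].
rewrite odd_tperm neq_ij expr1 mulN1r => gN; apply: two_reg.
by rewrite {1}gN addNr.
Qed.

Lemma vandermonde_restr_alt f n (s : 'S_n) :
  fps_perm s (vandermonde n * restr f n) = (-1) ^+ s * (vandermonde n * restr f n).
Proof.
rewrite [LHS](rmorphM (fps_perm s)) vandermondeE [X in X * _]alternant_perm -mulrA.
by congr (_ * (_ * _)); apply: fpsP => m; rewrite [LHS]restr_sym.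
Qed.

Lemma has_sum_schur f : has_sum (fun nu => schur_coef f nu *: schur nu) f.
Proof.
move=> n m; pose d := mdeg m.
(* These include all partitions of d with at most n parts, the only ones whose Schur functions have
   terms of degree d in n variables. *)
pose S0 := [fset nu in [seq part_of (map val (t : n.-tuple 'I_d.+1))
                       | t <- enum {: n.-tuple 'I_d.+1}]]%fset.
have S0P nu : (size nu <= n)%N -> part_size nu = d -> nu \in S0.
  move=> le_nu size_nu; rewrite !inE; apply/mapP.
  exists [tuple inord (nth 0%N nu i) | i < n]; first by rewrite mem_enum.
  have le_d (i : 'I_n) : (nth 0 nu i <= d)%N.
    by rewrite -size_nu (part_sizeE le_nu) (bigD1 i) //= leq_addr.
  set t := map _ _; have size_t : size t = n by rewrite size_map size_tuple.
  have nth_t i : nth 0%N t i = nth 0%N nu i.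
    have [lt_i|le_i] := ltnP i n; last first.
      by rewrite !nth_default ?size_t // (leq_trans le_nu).
    rewrite (nth_map ord0) ?size_tuple // -(tnth_nth _ _ (Ordinal lt_i)).
    by rewrite tnth_mktuple /= inordK // ltnS (le_d (Ordinal lt_i)).
  apply: partP => i; rewrite nth_part_of // -?nth_t //.
  apply/(sortedP 0%N) => j _; rewrite !nth_t; exact: part_mono.
exists S0 => S sub_S; apply/eqP; rewrite -subr_eq0; apply/eqP.
set g := \sum_(i <- S) _.
rewrite -[LHS]/(fcoef (restr (g - f) n) m).
apply: (regular_deg_vandermonde _ (erefl (mdeg m))).
apply: alternating_eq0 => [s|nu le_nu size_nu]; first exact: vandermonde_restr_alt.
rewrite schur_coefE // schur_coefB schur_coef_sum (big_fsetD1 nu) /=; last first.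
  by apply: (fsubsetP sub_S); apply: S0P.
rewrite schur_coefZ schur_coef_schur eqxx mulr1 big_seq big1 ?addr0 ?subrr // => la.
rewrite !inE => /andP[neq_la _]; rewrite schur_coefZ schur_coef_schur eq_sym.
by rewrite (negPf neq_la) mulr0.
Qed.

Lemma schur_coef_has_sum (c : intpart -> R) f :
  has_sum (fun nu => c nu *: schur nu) f -> forall nu, schur_coef f nu = c nu.
Proof.
move=> sum_f nu; pose n := size nu; pose m := stair n nu.
have [S0 S0P] := choice (sum_f n).
(* The coefficient of V f at m involves only finitely many coefficients of f, and S is large enough
   for all of them. *)
pose S := (nu |` \bigcup_(k <- enum {: 'X_{1..n < (mdeg m).+1}}) S0 k)%fset.
have nu_S : nu \in S by rewrite !inE eqxx.
pose g := \sum_(la <- S) c la *: schur la.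
have coef_g : schur_coef g nu = c nu.
  rewrite /g schur_coef_sum (big_fsetD1 nu) //= schur_coefZ schur_coef_schur.
  rewrite eqxx mulr1 big_seq big1 ?addr0 // => la.
  rewrite !inE => /andP[neq_la _]; rewrite schur_coefZ schur_coef_schur eq_sym.
  by rewrite (negPf neq_la) mulr0.
rewrite -coef_g /schur_coef -/n -/m mulrC [in RHS]mulrC !fcoefM_lin.
apply: eq_bigr => k _; congr (_ * _); rewrite /g S0P //.
apply: fsubset_trans (fsubsetU1 _ _).
by apply: (@bigfcup_sup _ _ _ k _ (fun k : 'X_{1..n < _} => S0 k)); rewrite ?mem_enum.
Qed.

Lemma schur_coef_inj f g : (forall nu, schur_coef f nu = schur_coef g nu) -> f = g.
Proof.
move=> eq_fg; apply: symfunP => n; apply: fpsP => m.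
have [Sf SfP] := has_sum_schur f m; have [Sg SgP] := has_sum_schur g m.
rewrite -(SfP (Sf `|` Sg)%fset) ?fsubsetUl // -(SgP (Sf `|` Sg)%fset) ?fsubsetUr //.
by under eq_bigr do rewrite eq_fg.
Qed.

Lemma has_sum_reindex (I : choiceType) (u : I -> symfun R) f (h : I -> I) :
  involutive h -> has_sum u f -> has_sum (fun i => u (h i)) f.
Proof.
move=> hK sum_f n m; have [S0 S0P] := sum_f n m.
exists (h @` S0)%fset => S sub_S; rewrite -(S0P (h @` S)%fset).
  by rewrite big_imfset //= => i j _ _; apply: (inv_inj hK).
apply/fsubsetP => i S0i; apply/imfsetP; exists (h i); rewrite /= ?hK //.
by apply: (fsubsetP sub_S); apply: in_imfset.
Qed.

(** The choice made in [omega] is harmless because Schur expansions are unique. *)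
Lemma omegaE f g :
  (forall nu, schur_coef g nu = schur_coef f (conj_part nu)) -> omega f = g.
Proof.
move=> fg; rewrite /omega; case: pselect => [ex|[]]; last first.
  exists g, (schur_coef f); split; first exact: has_sum_schur.
  have := has_sum_reindex conj_partK (has_sum_schur g).
  by congr has_sum; apply/funext => nu; rewrite fg conj_partK.
case: (cid ex) => g' [c [sum_f sum_g']] /=; apply: schur_coef_inj => nu.
rewrite fg (schur_coef_has_sum sum_f).
have /schur_coef_has_sum-> // :
    has_sum (fun nu => c (conj_part nu) *: schur nu) g'.
have := has_sum_reindex conj_partK sum_g'.
by congr has_sum; apply/funext => la; rewrite conj_partK.
Qed.

End HasSum.

(** * Duality *)

Lemma det_scale_rows_cols (R : comNzRingType) n (u v : 'I_n -> R) (A : 'M[R]_n) :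
  \det (\matrix_(i, j) (u i * A i j * v j)) = (\prod_i u i) * \det A * (\prod_j v j).
Proof.
have -> : \matrix_(i, j) (u i * A i j * v j) =
    diag_mx (\row_i u i) *m A *m diag_mx (\row_j v j).
  by apply/matrixP => i j; rewrite mul_mx_diag mxE mul_diag_mx !mxE.
rewrite !det_mulmx !det_diag; congr (_ * _ * _); by apply: eq_bigr => i _; rewrite mxE.
Qed.

(* Jacobi's complementary minor theorem, for a leading principal minor. *)
Lemma det_ulsubmx_inv (R : comNzRingType) n m (M N : 'M[R]_(n + m)) :
  N *m M = 1%:M -> \det (ulsubmx M) = \det M * \det (drsubmx N).
Proof.
move=> /mulmx1C MN; pose T := block_mx 1%:M (ursubmx N) 0 (drsubmx N).
have MT : M *m T = block_mx (ulsubmx M) 0 (dlsubmx M) 1%:M.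
  move: MN; rewrite -[M in M *m N]submxK -[N in _ *m N]submxK mulmx_block.
  rewrite scalar_mx_block => /eq_block_mx[_ ur0 _ dr1].
  rewrite -[M in M *m T]submxK mulmx_block ur0 dr1.
  by rewrite !mulmx1 !mulmx0 !addr0.
by have := congr1 determinant MT; rewrite det_mulmx det_ublock det_lblock !det1 mul1r mulr1.
Qed.

(** The Vandermonde determinant of the values of s has sign (-1)^(number of inversions) as a product
    of differences, and the sign of s as a column permutation of that of the identity. *)
Lemma odd_perm_inversions n (s : 'S_n) :
  odd_perm s = odd (\sum_(i < n) \sum_(j < n | (i < j)%N) (s j < s i)%N).
Proof.
pose V (t : 'S_n) : 'M[int]_n := Vandermonde n (\row_j (t j : nat)%:Z).
have detV t : \det (V t) = \prod_(i < n) \prod_(j < n | (i < j)%N)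
    ((t j)%:Z - (t i)%:Z).
  by rewrite det_Vandermonde; apply: eq_bigr => i _; apply: eq_bigr => j _; rewrite !mxE.
have sgV t : sgz (\det (V t)) =
    (-1) ^+ (\sum_(i < n) \sum_(j < n | (i < j)%N) (t j < t i)%N).
  rewrite detV (big_morph _ (@sgzM int) (sgz1 int)) expr_sum; apply: eq_bigr => i _.
  rewrite (big_morph _ (@sgzM int) (sgz1 int)) expr_sum; apply: eq_bigr => j lt_ij.
  have neq_t : (t i : nat) != t j.
    by apply: contraTneq lt_ij => /val_inj/perm_inj->; rewrite ltnn.
  case: (ltngtP (t i) (t j)) neq_t => // lt_t _.
    by rewrite gtr0_sgz // subr_gt0 ltz_nat.
  by rewrite ltr0_sgz // subr_lt0 ltz_nat.
have V_s : V s = V 1%g *m perm_mx s^-1%g.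
  by rewrite -col_permE; apply/matrixP => i j; rewrite !mxE perm1.
have := congr1 (fun A => sgz (\det A)) V_s.
rewrite det_mulmx det_perm odd_permV sgzM !sgV [X in _ = (-1) ^+ X * _]big1 => [|i _].
  rewrite expr0 mul1r -signr_odd.
  have -> : sgz ((-1) ^+ s : int) = (-1) ^+ s by case: (odd_perm s).
  by move/signr_inj.
by rewrite big1 // => j lt_ij; rewrite !perm1 ltnNge (ltnW lt_ij).
Qed.

(** * Boundary paths in a box *)

Section Box.
Variables (n m : nat).

Definition in_box (la : intpart) := (size la <= n)%N && (size (conj_part la) <= m)%N.

Implicit Types la nu : intpart.

(* The boundary path of a partition in an n x m box: the rows and columns    *)
(* are the vertical and horizontal steps, placed on disjoint positions.      *)
Definition step_pos la (s : 'I_(n + m)) : nat :=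
  match split s with
  | inl j => nth 0 la j + (n - j.+1)
  | inr k => n + k - nth 0 (conj_part la) k
  end.

Lemma part_le_box la i : in_box la -> (nth 0 la i <= m)%N.
Proof.
case/andP => _ le_m; rewrite leqNgt -ltn_conj.
by rewrite (nth_default 0%N) // ltn0.
Qed.

Lemma conj_le_box la k : in_box la -> (nth 0 (conj_part la) k <= n)%N.
Proof.
case/andP => le_n _; rewrite leqNgt ltn_conj.
by rewrite (nth_default 0%N) // ltn0.
Qed.

Lemma step_pos_l la (j : 'I_n) : step_pos la (lshift m j) = (nth 0 la j + (n - j.+1))%N.
Proof. by rewrite /step_pos (unsplitK (inl j)). Qed.

Lemma step_pos_r la (k : 'I_m) :
  step_pos la (rshift n k) = (n + k - nth 0 (conj_part la) k)%N.
Proof. by rewrite /step_pos (unsplitK (inr k)). Qed.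

Lemma step_pos_lt la s : in_box la -> (step_pos la s < n + m)%N.
Proof.
move=> box; case: (split_ordP s) => i ->.
  by rewrite step_pos_l; have := part_le_box i box; have := ltn_ord i; lia.
by rewrite step_pos_r; have := ltn_ord i; lia.
Qed.

(** Horizontal step k comes before vertical step j exactly when the box (j,k) lies in the
    diagram. *)
Lemma step_cross la (j : 'I_n) (k : 'I_m) : in_box la ->
  (step_pos la (rshift n k) < step_pos la (lshift m j))%N = (k < nth 0 la j)%N
  /\ step_pos la (rshift n k) <> step_pos la (lshift m j).
Proof.
move=> box; rewrite step_pos_l step_pos_r.
have := ltn_conj la j k; have := conj_le_box k box; have := ltn_ord j; have := ltn_ord k.
move: (nth _ _ _) (nth _ _ _) => c l; split; lia.
Qed.

Lemma step_pos_inj la : in_box la -> injective (step_pos la).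
Proof.
move=> box s t; case: (split_ordP s) => i ->; case: (split_ordP t) => j ->.
- rewrite !step_pos_l => eq_ij; congr lshift; apply/val_inj/eqP => /=.
  have [lt_ij|lt_ji|//] := ltngtP i j.
    by have := stair_dec la lt_ij; rewrite eq_ij ltnn.
  by have := stair_dec la lt_ji; rewrite eq_ij ltnn.
- by move=> eq_ij; case: (step_cross i j box) => _ [].
- by move=> eq_ij; case: (step_cross j i box) => _ [].
rewrite !step_pos_r => eq_ij; congr rshift; apply/val_inj => /=.
have := part_mono (conj_part la) (i := i) (j := j).
have := part_mono (conj_part la) (i := j) (j := i).
have := conj_le_box i box; have := conj_le_box j box; lia.
Qed.

Section Steps.
Variables (la : intpart) (box : in_box la).

Definition step_ord s : 'I_(n + m) := Ordinal (step_pos_lt s box).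

Lemma step_ord_inj : injective step_ord.
Proof. by move=> s t /(congr1 val); apply: step_pos_inj. Qed.

Definition step_perm : 'S_(n + m) := perm step_ord_inj.

Lemma step_permE s : step_perm s = step_pos la s :> nat.
Proof. by rewrite permE. Qed.

(** Two vertical steps are always inverted and two horizontal ones never; a vertical and a
    horizontal step are inverted once for each box of the diagram. *)
Lemma odd_step_perm : odd_perm step_perm =
  odd (\sum_(i < n) \sum_(j < n | (i < j)%N) 1 + part_size (conj_part la)).
Proof.
rewrite odd_perm_inversions; congr (odd _).
rewrite big_split_ord /= [X in (_ + X)%N]big1 ?addn0 => [|k _]; last first.
  rewrite big1 // => t lt_kt; rewrite !step_permE.
  case: (split_ordP t) lt_kt => [j ->|k' ->] /=; first by have := ltn_ord j; lia.
  rewrite !step_pos_r ltn_add2l => lt_kk.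
  have := part_mono (conj_part la) (ltnW lt_kk).
  by have := conj_le_box k' box; have := conj_le_box k box; lia.
have size_m : (size (conj_part la) <= m)%N by case/andP: box.
rewrite (part_sizeE size_m).
have -> : (\sum_(k < m) nth 0 (conj_part la) k =
    \sum_(j < n) \sum_(k < m) (k < nth 0 la j))%N.
  rewrite exchange_big /=; apply: eq_bigr => k _.
  under eq_bigr do rewrite -ltn_conj.
  have := conj_le_box k box; move: (nth _ _ _) => c le_cn.
  elim: n c le_cn => [|p IHp] c le_c; first by rewrite big_ord0; lia.
  rewrite big_ord_recr /=; case: (ltngtP c p.+1) le_c => // [lt_c|->] _.
    by rewrite -IHp //; lia.
  rewrite (eq_bigr (fun=> 1%N)) => [|i _]; last by rewrite ltnW // ltnS ltn_ord.
  by rewrite sum1_card card_ord addn1.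
rewrite -big_split /=; apply: eq_bigr => i _.
rewrite big_mkcond big_split_ord -big_mkcond /=; congr (_ + _)%N.
  apply: eq_bigr => j lt_ij; rewrite !step_permE !step_pos_l.
  by rewrite (stair_dec la lt_ij).
apply: eq_bigr => k _; rewrite !step_permE.
have [-> _] := step_cross i k box.
by have -> : (i < n + k)%N by have := ltn_ord i; lia.
Qed.

End Steps.
End Box.

Section Duality.
Variables (R : comNzRingType) (a b : R).

Lemma ucoef_poly_gt i j k : (i + j < k)%N ->
  ucoef ((1 + b *: uX) ^+ i * (1 - a *: uX) ^+ j) k = 0.
Proof.
have deg_mul (f : fps R 1) c d : (forall k, (d < k)%N -> ucoef f k = 0) ->
    forall k, (d.+1 < k)%N -> ucoef (f * (1 + c *: uX)) k = 0.
  move=> f0 [|l] // lt_l; rewrite mulrDr mulr1 [f * _]mulrC -scalerAl.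
  rewrite -[LHS]/(ucoef f _ + c * ucoef (uX * f) _) ucoefXM !f0 ?mulr0 ?addr0 //.
  exact: ltnW.
elim: j k => [|j IHj] k.
  rewrite mulr1 addn0; elim: i k => [|i IHi] k lt_k.
    by rewrite ucoef1; case: k lt_k.
  by rewrite exprSr (deg_mul _ _ i).
rewrite addnS => lt_k; rewrite exprSr mulrA.
by have := deg_mul _ (- a) _ IHj k lt_k; rewrite scaleNr.
Qed.

Variables (n m : nat) (la : intpart).
Hypothesis box_la : in_box n m la.

(* col_exps counts the vertical steps above and the horizontal steps up to s, *)
(* row_exps the vertical steps from s on and the horizontal steps below s:    *)
(* for a step c below r, col_series c * row_series r is then a polynomial of  *)
(* degree one less than the gap between c and r, whence row_col_mx.           *)
Definition col_exps (s : 'I_(n + m)) : nat * nat :=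
  match split s with
  | inl j => (j : nat, nth 0 la j)
  | inr k => (nth 0 (conj_part la) k, k.+1)
  end%N.

Definition row_exps (s : 'I_(n + m)) : nat * nat :=
  match split s with
  | inl j => (j.+1, nth 0 la j)
  | inr k => (nth 0 (conj_part la) k, k : nat)
  end%N.

Definition col_series s : fps R 1 :=
  (1 + b *: uX) ^+ (col_exps s).1 * geo a ^+ (col_exps s).2.

Definition row_series s : fps R 1 :=
  geo (- b) ^+ (row_exps s).1 * (1 - a *: uX) ^+ (row_exps s).2.

(** The two differences count the vertical and the horizontal steps strictly between c and r. *)
Lemma exps_gap r c : (step_pos la c < step_pos la r)%N ->
  [/\ (row_exps r).1 <= (col_exps c).1, (col_exps c).2 <= (row_exps r).2 &
   ((col_exps c).1 - (row_exps r).1) + ((row_exps r).2 - (col_exps c).2)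
     < step_pos la r - step_pos la c]%N.
Proof.
rewrite /row_exps /col_exps.
have := conj_le_box (la := la) ^~ box_la; have := ltn_conj la.
have := @part_mono (conj_part la); have := @part_mono la.
case: (split_ordP r) => i ->; case: (split_ordP c) => j ->;
  rewrite ?(unsplitK (inl i)) ?(unsplitK (inr i)) ?(unsplitK (inl j)) ?(unsplitK (inr j));
  rewrite ?step_pos_l ?step_pos_r;
  move: (nth 0%N la) (nth 0%N (conj_part la)) => x y x_mono y_mono xy y_le /= lt_cr;
  have := ltn_ord i; have := ltn_ord j.
- have lt_ij : (i < j)%N.
    rewrite ltnNge; apply/negP => /[dup] le_ji /x_mono.
    by have := ltn_ord i; have := ltn_ord j; lia.
  by have := x_mono _ _ (ltnW lt_ij); split; lia.
- by have := xy i j; have := y_le j; split; lia.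
- by have := xy j i; have := y_le i; split; lia.
have lt_ji : (j < i)%N.
  rewrite ltnNge; apply/negP => /[dup] le_ij /y_mono.
  by have := y_le j; have := y_le i; lia.
by have := y_mono _ _ (ltnW lt_ji); have := y_le j; have := y_le i; split; lia.
Qed.

Lemma col_row_series r c : (step_pos la c < step_pos la r)%N ->
  ucoef (col_series c * row_series r) (step_pos la r - step_pos la c) = 0.
Proof.
case/exps_gap; rewrite /col_series /row_series.
move: (col_exps c).1 (col_exps c).2 (row_exps r).1 (row_exps r).2 => B A B' A'.
move=> le_B le_A lt_d.
have geoA : geo a ^+ A * (1 - a *: uX) ^+ A = 1 by rewrite -exprMn geoV expr1n.
have geoB : (1 + b *: uX) ^+ B' * geo (- b) ^+ B' = 1.
  by rewrite mulrC -exprMn -[b]opprK scaleNr opprK geoV expr1n.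
rewrite -(subnKC le_B) -(subnKC le_A) !exprD.
rewrite [X in ucoef X](_ : _ = ((1 + b *: uX) ^+ B' * geo (- b) ^+ B') *
  (geo a ^+ A * (1 - a *: uX) ^+ A) *
  ((1 + b *: uX) ^+ (B - B') * (1 - a *: uX) ^+ (A' - A))); last by ring.
by rewrite geoA geoB !mul1r ucoef_poly_gt.
Qed.

Lemma col_row_series0 r : ucoef (col_series r * row_series r) 0 = 1.
Proof.
rewrite ucoef0M ucoef0_unit mul1r /row_series mulrC -[a]opprK scaleNr opprK.
exact: ucoef0_unit.
Qed.

Definition col_mx_of nu : 'M[R]_(n + m) :=
  \matrix_(s, c) ucoef (uX ^+ step_pos la c * col_series c) (step_pos nu s).

Definition row_mx_of nu : 'M[R]_(n + m) :=
  \matrix_(r, s) if (step_pos nu s <= step_pos la r)%N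
                 then ucoef (row_series r) (step_pos la r - step_pos nu s) else 0.

(** The steps of nu run through all positions once, so each entry of the product is a convolution: a
    coefficient of a column series times a row series. *)
Lemma row_col_mx nu : in_box n m nu -> row_mx_of nu *m col_mx_of nu = 1%:M.
Proof.
move=> box_nu; apply/matrixP => r c; rewrite !mxE.
transitivity (ucoef (uX ^+ step_pos la c * col_series c * row_series r) (step_pos la r)).
  rewrite ucoefM (big_ord_widen (n + m)
    (fun t => ucoef (uX ^+ step_pos la c * col_series c) t
              * ucoef (row_series r) (step_pos la r - t))) ?step_pos_lt //.
  rewrite [RHS]big_mkcond [RHS](reindex_inj (@perm_inj _ (step_perm box_nu))).
  apply: eq_bigr => s _; rewrite !mxE !step_permE ltnS.
  by case: ifP; rewrite ?mul0r // mulrC.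
rewrite -mulrA ucoefXnM; case: leqP => [|lt_rc]; last first.
  by case: eqP lt_rc => // ->; rewrite ltnn.
rewrite leq_eqVlt => /orP[/eqP/(step_pos_inj box_la)->|lt_cr].
  by rewrite subnn col_row_series0 eqxx.
by rewrite col_row_series //; case: eqP lt_cr => // ->; rewrite ltnn.
Qed.

(** With rows and columns sorted by position the matrix is unitriangular. *)
Lemma det_col_mx nu (box_nu : in_box n m nu) :
  \det (col_mx_of nu) = (-1) ^+ (step_perm box_nu (+) step_perm box_la).
Proof.
pose T : 'M[R]_(n + m) :=
  \matrix_(p, q) ucoef (uX ^+ q * col_series ((step_perm box_la)^-1 q)%g) p.
have -> : col_mx_of nu = row_perm (step_perm box_nu) (col_perm (step_perm box_la) T).
  by apply/matrixP => s c; rewrite !mxE permK !step_permE.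
have T_trig : is_trig_mx T.
  by apply/is_trig_mxP => p q lt_pq; rewrite mxE ucoefXnM leqNgt lt_pq.
rewrite row_permE col_permE !det_mulmx !det_perm odd_permV (det_trig T_trig).
rewrite big1 ?mul1r => [|p _]; first by rewrite -signr_addb.
by rewrite mxE ucoefXnM leqnn subnn ucoef0_unit.
Qed.

End Duality.

Section DualityTheorem.
Variables (R : comNzRingType) (a b : R).

Lemma schur_coef_conj la nu :
  schur_coef (grothendieck a b la) nu =
  schur_coef (grothendieck b a (conj_part la)) (conj_part nu).
Proof.
pose n := maxn (size la) (size nu); pose m := maxn (size (conj_part la)) (size (conj_part nu)).
have box_la : in_box n m la by rewrite /in_box !leq_maxl.
have box_nu : in_box n m nu by rewrite /in_box !leq_maxr.
rewrite (@schur_coef_grothendieck _ n) ?leq_maxl ?leq_maxr //.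
rewrite (@schur_coef_grothendieck _ m) ?leq_maxl ?leq_maxr //.
set G := (X in \det X); set G' := (X in _ = \det X).
have -> : G = ulsubmx (col_mx_of a b n m la nu).
  apply/matrixP => i j; rewrite !mxE !step_pos_l /gcol /col_series /col_exps.
  by rewrite (unsplitK (inl j)) mulrA.
rewrite (det_ulsubmx_inv (row_col_mx a b box_la box_nu)) (det_col_mx a b box_la box_nu).
pose u (i : 'I_m) := (nth 0 (conj_part nu) i + (m - i.+1))%N.
pose v (i : 'I_m) := (nth 0 (conj_part la) i + (m - i.+1))%N.
(* The horizontal position n + i - nu'_i is n + m - 1 - u i, so differences of positions are
   reversed and the minor is transposed; x -> -x accounts for the signs. *)
have -> : drsubmx (row_mx_of a b n m la nu) =
    (\matrix_(i, j) ((-1) ^+ u i * G' i j * (-1) ^+ v j))^T.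
  apply/matrixP => j i; rewrite /G' !mxE !step_pos_r /gcol -[uX ^+ _ * _ * _]mulrA.
  rewrite ucoefXnM -/(u i) -/(v j).
  have := conj_le_box i box_nu; have := conj_le_box j box_la.
  have := ltn_ord i; have := ltn_ord j => lt_j lt_i le_j le_i.
  have -> : (n + i - nth 0 (conj_part nu) i <= n + j - nth 0 (conj_part la) j)%N
      = (v j <= u i)%N by rewrite /u /v; lia.
  have [le_vu|_] := leqP; last by rewrite mulr0 mul0r.
  have -> : (n + j - nth 0 (conj_part la) j - (n + i - nth 0 (conj_part nu) i)
    = u i - v j)%N by rewrite /u /v; lia.
  rewrite mulrAC -exprD -signr_odd oddD -oddB // signr_odd -ucoef_twist.
  by rewrite fps_twist_units mulrC /row_series /row_exps (unsplitK (inr j)) mulrC.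
rewrite det_tr det_scale_rows_cols !prodrXr.
rewrite mulrAC -exprD -[(-1) ^+ (_ + _)]signr_odd mulrA -signr_addb.
have sum_stair ka (box : in_box n m ka) : (\sum_(i < m) (nth 0 (conj_part ka) i + (m - i.+1))
    = part_size (conj_part ka) + \sum_(i < m) (m - i.+1))%N.
  by rewrite big_split (@part_sizeE _ m) //; case/andP: box.
(* The staircase sums of n and of m occur twice each, and so do |la'| and |nu'|: once from the
   minor, once from the path permutations. *)
rewrite /u /v !sum_stair // !odd_step_perm !oddD.
by do 4!case: (odd _); rewrite mul1r.
Qed.

Theorem omega_grothendieck la : (forall x : R, x + x = 0 -> x = 0) ->
  omega (grothendieck a b la) = grothendieck b a (conj_part la).
Proof.
move=> two_reg; apply: (omegaE two_reg) => nu.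
by rewrite [RHS]schur_coef_conj conj_partK.
Qed.

End DualityTheorem.

(** * Products *)

Section Order.
Context {R : comNzRingType} {n : nat}.
Implicit Types f g : fps R n.

Definition order_ge f k := forall m, (mdeg m < k)%N -> fcoef f m = 0.

Lemma order_geM f g k l : order_ge f k -> order_ge g l -> order_ge (f * g) (k + l).
Proof.
move=> ord_f ord_g m lt_m; rewrite fcoefM_lin big1 // => j le_jm.
have [lt_j|le_j] := ltnP (mdeg j) k; first by rewrite ord_f ?mul0r.
rewrite ord_g ?mulr0 //; move: lt_m; rewrite -{1}(submK le_jm) mdegD; lia.
Qed.

Lemma order_ge_prod (I : Type) (r : seq I) (P : pred I) F e :
    (forall i, P i -> order_ge (F i) (e i)) ->
  order_ge (\prod_(i <- r | P i) F i) (\sum_(i <- r | P i) e i).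
Proof.
move=> ord_F; apply: (big_rec2 order_ge) => // i e' g Pi.
exact/order_geM/ord_F.
Qed.

Lemma order_ge_vandermonde :
  order_ge (vandermonde n : fps R n) (\sum_(i < n) (n - i.+1)).
Proof.
under eq_bigr do rewrite -sum_gt_ord.
apply: order_ge_prod => i _; apply: order_ge_prod => j lt_ij m.
rewrite ltnS leqn0 mdeg_eq0 => /eqP->.
by rewrite /= ![0%MM == _]eq_sym !mnm1_eq0 subr0.
Qed.

End Order.

Lemma mdeg_stair n (la : intpart) : (size la <= n)%N ->
  mdeg (stair n la) = (\sum_(i < n) (n - i.+1) + part_size la)%N.
Proof.
move=> le_n; rewrite mdegE (part_sizeE le_n) addnC -big_split.
by apply: eq_bigr => i _; rewrite mnmE.
Qed.

Lemma schur_coef_order (R : comNzRingType) (f : symfun R) n d (nu : intpart) :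
  (size nu <= n)%N -> (part_size nu < d)%N -> order_ge (restr f n) d ->
  schur_coef f nu = 0.
Proof.
move=> le_n lt_d ord_f; rewrite -(schur_coefE _ le_n).
apply: (order_geM order_ge_vandermonde ord_f).
by rewrite mdeg_stair // ltn_add2l.
Qed.

(** Its Schur coefficients below size |la| vanish, and V is regular degree by degree. *)
Lemma order_grothendieck (R : comNzRingType) (a b : R) la n :
  (forall x : R, x + x = 0 -> x = 0) ->
  order_ge (restr (grothendieck a b la) n) (part_size la).
Proof.
move=> two_reg m lt_m; apply: (regular_deg_vandermonde _ (erefl (mdeg m))).
apply: (alternating_eq0 two_reg) => [s|nu le_nu size_nu].
  exact: vandermonde_restr_alt.
rewrite schur_coefE // schur_coef_grothendieck_le ?size_nu ?(ltnW lt_m) //.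
by case: eqP size_nu lt_m => // -> ->; rewrite ltnn.
Qed.

Section MpolyToFps.
Context {R : comNzRingType} {n : nat}.

(** The numerators of G^(0,-1) are polynomials, in which series can be substituted freely. *)
Definition fps_of_mpoly (p : {mpoly R[n]}) : fps R n := Fps (fun m => p@_m).

Fact fps_of_mpoly_zmod : zmod_morphism fps_of_mpoly.
Proof. by move=> p q; apply: fpsP => m; rewrite /= mcoeffB. Qed.

Fact fps_of_mpoly_monoid : monoid_morphism fps_of_mpoly.
Proof.
split=> [|p q]; apply: fpsP => m; first by rewrite /= mcoeff1.
exact/esym/fps_trunc_mul.
Qed.

HB.instance Definition _ := GRing.isZmodMorphism.Build {mpoly R[n]} (fps R n)
  fps_of_mpoly fps_of_mpoly_zmod.
HB.instance Definition _ := GRing.isMonoidMorphism.Build {mpoly R[n]} (fps R n)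
  fps_of_mpoly fps_of_mpoly_monoid.

Lemma fps_of_mpoly_inj : injective fps_of_mpoly.
Proof.
by move=> p q eq_pq; apply/mpolyP => m; apply: (congr1 (fun f => fcoef f m) eq_pq).
Qed.

Lemma fps_of_mpolyX i : fps_of_mpoly 'X_i = fps_var i.
Proof. by apply: fpsP => m; rewrite /= mcoeffX eq_sym. Qed.

Lemma fps_of_mpolyZ c p : fps_of_mpoly (c *: p) = c *: fps_of_mpoly p.
Proof. by apply: fpsP => m; rewrite /= mcoeffZ. Qed.

End MpolyToFps.

(** * The substitution x -> -(a + b) x / (1 - a x) *)

Section Numerators.
Variable n : nat.
Implicit Types la : intpart.

Definition poly_num la : {mpoly int[n]} :=
  \det (\matrix_(i, j) ('X_i ^+ (nth 0%N la j + (n - j.+1)) * (1 - 'X_i) ^+ j)).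

Definition poly_vandermonde : {mpoly int[n]} :=
  \prod_(i < n) \prod_(j < n | (i < j)%N) ('X_i - 'X_j).

Lemma fps_of_poly_num la :
  fps_of_mpoly (poly_num la) = alternant (@gcol int 0 (-1) la n).
Proof.
rewrite -[LHS]/(_ (\det _)) -det_map_mx; congr (\det _); apply/matrixP => i j.
rewrite !mxE /gcol geo0 expr1n mulr1 scaleN1r.
rewrite !rmorphM !rmorphXn !rmorphB !rmorph1 -[GRing.RMorphism.sort _ _]/(fps_of_mpoly 'X_i).
by rewrite fps_of_mpolyX -embX.
Qed.

Lemma fps_of_poly_vandermonde : fps_of_mpoly poly_vandermonde = vandermonde n.
Proof.
rewrite rmorph_prod; apply: eq_bigr => i _; rewrite rmorph_prod.
by apply: eq_bigr => j _; rewrite rmorphB; congr (_ - _); apply: fps_of_mpolyX.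
Qed.

Section Substitution.
Variables (R : comNzRingType) (a b : R).

Let t : fps R n := (- (a + b)) *: 1.
Let g (i : 'I_n) : fps R n := emb i (geo a).
Let w : fps R n := \prod_i (g i ^+ n.-1) * t ^+ (\sum_(i < n) (n - i.+1)).

(* The substitution x -> - (a + b) x / (1 - a x) turns the numerators of     *)
(* G^(0,-1) into those of G^(a,b), up to factors that do not depend on la.   *)
Definition mobius : {mpoly int[n]} -> fps R n :=
  mmap intr (fun i => t * (fps_var i * g i)).

Lemma geo_var i : g i * (1 - a *: fps_var i) = 1.
Proof. by rewrite /g -embX -embZ -(rmorph1 (emb i)) -rmorphB -rmorphM geoV. Qed.

(** This is 1 + (a + b) x / (1 - a x) = (1 + b x) / (1 - a x). *)
Lemma mobius_factor i : 1 - t * (fps_var i * g i) = g i * (1 + b *: fps_var i).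
Proof.
have := geo_var i; rewrite /t -[a *: _]mulr_algl -[b *: _]mulr_algl.
move: (g i) (fps_var i) => y x.
rewrite scaleNr scalerDl; move: (a *: 1) (b *: 1) => A B yE.
by rewrite -{1}yE; ring.
Qed.

Lemma mobiusX i : mobius 'X_i = t * (fps_var i * g i).
Proof. by rewrite /mobius mmapX mmap1U. Qed.

Lemma mobius_num la : (size la <= n)%N ->
  mobius (poly_num la) = w * t ^+ part_size la * alternant (@gcol R a b la n).
Proof.
move=> le_n; pose P (j : 'I_n) := (nth 0 la j + (n - j.+1))%N.
have -> : w * t ^+ part_size la * alternant (@gcol R a b la n) =
    (\prod_i g i ^+ n.-1) * alternant (@gcol R a b la n) * (\prod_j t ^+ P j).
  rewrite prodrXr big_split /= -part_sizeE // exprD /w; ring.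
rewrite -det_scale_rows_cols /mobius -det_map_mx; congr (\det _).
apply/matrixP => i j; rewrite !mxE -/(P j) rmorphM !rmorphXn rmorphB rmorph1.
rewrite -[GRing.RMorphism.sort _ _]/(mobius 'X_i) mobiusX mobius_factor.
rewrite emb_gcol -/(P j) -/(g i) !exprMn.
(* The powers of 1 / (1 - a x_i) add up to la_j + n - 1, so apart from those in [gcol] they depend
   only on the row. *)
have gE : g i ^+ P j * g i ^+ j = g i ^+ n.-1 * g i ^+ nth 0%N la j.
  by rewrite -!exprD; congr (_ ^+ _); rewrite /P; have := ltn_ord j; lia.
move: gE; move: (t ^+ P j) (fps_var i ^+ P j) (g i ^+ P j) (g i ^+ j).
move: ((1 + _) ^+ j) => v u x y z.
move: (g i ^+ n.-1) (g i ^+ nth _ _ _) => r l yz.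
by transitivity (u * x * v * (y * z)); [ring | rewrite yz; ring].
Qed.

(** The difference of x / (1 - a x) and y / (1 - a y) is (x - y) / ((1 - a x)(1 - a y)), and each
    variable occurs in n - 1 differences. *)
Lemma mobius_vandermonde : mobius poly_vandermonde = w * vandermonde n.
Proof.
rewrite /mobius rmorph_prod.
transitivity (\prod_(i < n) \prod_(j < n | (i < j)%N)
    ((g i * g j) * t * (fps_var i - fps_var j))).
  apply: eq_bigr => i _; rewrite rmorph_prod; apply: eq_bigr => j _.
  rewrite rmorphB -[GRing.RMorphism.sort _ 'X_i]/(mobius 'X_i).
  rewrite -[GRing.RMorphism.sort _ 'X_j]/(mobius 'X_j) !mobiusX.
  have := geo_var i; have := geo_var j.
  rewrite -(mulr_algl a (fps_var i)) -(mulr_algl a (fps_var j)).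
  move: (g i) (g j) (fps_var i) (fps_var j) (a *: 1) => y z x x' A zE yE.
  transitivity (t * ((x * y) * (z * (1 - A * x'))) - t * ((x' * z) * (y * (1 - A * x)))).
    by rewrite yE zE !mulr1.
  by ring.
transitivity ((\prod_(i < n) \prod_(j < n | (i < j)%N) (g i * g j)) *
    (\prod_(i < n) \prod_(j < n | (i < j)%N) t) * vandermonde n).
  rewrite -!big_split; apply: eq_bigr => i _; rewrite -!big_split.
  by apply: eq_bigr => j _.
congr (_ * _ * _); last first.
  under [in RHS]eq_bigr do rewrite -sum_gt_ord.
  by rewrite expr_sum; apply: eq_bigr => i _; rewrite expr_sum.
transitivity ((\prod_(i < n) \prod_(j < n | (i < j)%N) g i) *
    (\prod_(i < n) \prod_(j < n | (i < j)%N) g j)).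
  by rewrite -big_split; apply: eq_bigr => i _; rewrite -big_split.
rewrite [X in _ * X](exchange_big_dep predT) //= -big_split; apply: eq_bigr => i _.
transitivity (\prod_(j < n | j != i) g i); last by rewrite prodr_const cardC1 card_ord.
rewrite [RHS](bigID (fun j : 'I_n => i < j)%N).
apply: (congr2 *%R); apply: eq_bigl => j /=.
  by rewrite neq_ltn; case: ltngtP.
by rewrite neq_ltn; case: ltngtP.
Qed.

End Substitution.
End Numerators.

Lemma restr_mul_alternant (R : comNzRingType) (a b : R) (la mu : intpart)
    (S : seq intpart) (d : intpart -> R) n :
    (size la <= n)%N -> (size mu <= n)%N -> (forall nu, nu \in S -> (size nu <= n)%N) ->
  restr (grothendieck a b la * grothendieck a b mu) n
    = restr (\sum_(nu <- S) d nu *: grothendieck a b nu) n <->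
  alternant (@gcol R a b la n) * alternant (@gcol R a b mu n)
    = \sum_(nu <- S) d nu *: (alternant (@gcol R a b nu n) * vandermonde n).
Proof.
move=> le_la le_mu le_S.
rewrite -[restr (_ * _) n]/(restr (grothendieck a b la) n * restr (grothendieck a b mu) n).
rewrite restr_sum -!restr_grothendieck //.
set x := restr _ n; set y := restr _ n; set V := vandermonde n; set z := \sum_(nu <- S) _.
rewrite [X in _ <-> _ = X](_ : _ = V * (V * z)).
  rewrite mulrACA -mulrA; split=> [->//|eqV].
  by apply: vandermonde_inj; apply: vandermonde_inj.
rewrite /z !mulr_sumr; apply: eq_big_seq => nu /le_S le_nu.
rewrite -restr_grothendieck // -[restr (_ *: _) n]/(d nu *: restr _ n).
by rewrite !fps_scalerAr -/V; congr (_ *: _); ring.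
Qed.

Section Product.
Variables (la mu : intpart) (c : {fsfun intpart -> nat with 0%N}).
Let K := (part_size la + part_size mu)%N.
Let e nu := (part_size nu - part_size la - part_size mu)%N.
Hypothesis int_product : grothendieck 0 (-1) la * grothendieck 0 (-1) mu
  = \sum_(nu <- finsupp c) ((-1) ^+ e nu *+ c nu) *: grothendieck 0 (-1) nu :> symfun int.

(** By induction on |nu|: if |nu| < K, the product has no s_nu, while on the right only G_nu
    contributes to s_nu, so c nu = 0. Thus the truncated subtraction in e is exact on the
    support. *)
Lemma product_support nu : nu \in finsupp c -> (K <= part_size nu)%N.
Proof.
have two_reg (x : int) : x + x = 0 -> x = 0 by lia.
have [k] := ubnP (part_size nu); elim: k nu => // k IHk nu lt_k nu_c.
rewrite leqNgt; apply/negP => lt_K.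
have : schur_coef (grothendieck 0 (-1) la * grothendieck 0 (-1) mu : symfun int) nu = 0.
  apply: (@schur_coef_order _ _ (size nu) K) => //.
  by apply: order_geM; apply: order_grothendieck.
rewrite int_product schur_coef_sum (big_fsetD1 nu) //= schur_coefZ.
rewrite schur_coef_grothendieck_le // eqxx mulr1 big_seq big1 ?addr0 => [/eqP|ka].
  by rewrite mulrn_eq0 signr_eq0 orbF -[_ == _]negbK -mem_finsupp nu_c.
rewrite !inE => /andP[neq_ka ka_c]; rewrite schur_coefZ schur_coef_grothendieck_le.
  by rewrite eq_sym (negPf neq_ka) mulr0.
rewrite leqNgt; apply/negP => lt_ka.
by have := IHk ka (leq_trans lt_ka lt_k) ka_c; lia.
Qed.

Theorem grothendieck_mul (R : comNzRingType) (a b : R) : GRing.lreg (a + b) ->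
  grothendieck a b la * grothendieck a b mu
    = \sum_(nu <- finsupp c) ((a + b) ^+ e nu *+ c nu) *: grothendieck a b nu.
Proof.
move=> ab_reg.
pose N := maxn (maxn (size la) (size mu)) (\max_(nu <- finsupp c) size nu).
apply: (@restr_eq_large _ N) => n; rewrite !geq_max -andbA => /and3P[le_la le_mu le_c].
have le_S nu : nu \in finsupp c -> (size nu <= n)%N.
  by move=> nu_c; apply: leq_trans le_c; apply: leq_bigmax_seq.
apply/restr_mul_alternant => //.
have [/(_ (congr1 (fun f => restr f n) int_product)) eq_int _] :=
  @restr_mul_alternant int 0 (-1) la mu (finsupp c) (fun nu => (-1) ^+ e nu *+ c nu)
    n le_la le_mu le_S.
have eq_poly : poly_num n la * poly_num n mu =
    \sum_(nu <- finsupp c) ((-1) ^+ e nu *+ c nu) *: (poly_num n nu * poly_vandermonde n).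
  apply: fps_of_mpoly_inj.
  transitivity (fps_of_mpoly (poly_num n la) * fps_of_mpoly (poly_num n mu)).
    exact: rmorphM.
  rewrite !fps_of_poly_num eq_int raddf_sum; apply: eq_bigr => nu _.
  rewrite -[RHS]/(fps_of_mpoly _) fps_of_mpolyZ; congr (_ *: _).
  rewrite -fps_of_poly_num -fps_of_poly_vandermonde; exact/esym/rmorphM.
pose t : fps R n := (- (a + b)) *: 1.
pose w : fps R n := \prod_i (emb i (geo a) ^+ n.-1) * t ^+ (\sum_(i < n) (n - i.+1)).
have t_reg : GRing.lreg t.
  move=> x y eq_xy; apply: fpsP => m; apply: ab_reg; apply: oppr_inj.
  have := congr1 (fun f => fcoef f m) eq_xy; rewrite /t !mulr_algl.
  by rewrite -[fcoef (_ *: x) m]/(_ * _) -[fcoef (_ *: y) m]/(_ * _) !mulNr.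
have w_reg : GRing.lreg w.
  apply: lregM; last exact: lregX.
  apply: big_ind => [|x y|i _]; [exact: lreg1|exact: lregM|apply: lregX].
  apply: (can_inj (g := fun x => (1 - a *: fps_var i) * x)) => x.
  by rewrite mulrA [_ * emb _ _]mulrC geo_var mul1r.
have W_reg : injective ( *%R (w * w * t ^+ K)).
  exact: (lregM (lregM w_reg w_reg) (@lregX _ _ K t_reg)).
apply: W_reg.
have mobM p q : mobius a b (p * q) = mobius a b p * mobius a b q :> fps R n.
  exact: rmorphM.
transitivity (mobius a b (poly_num n la) * mobius a b (poly_num n mu)).
  by rewrite !mobius_num // -/t -/w /K exprD; ring.
rewrite -mobM eq_poly [LHS]raddf_sum mulr_sumr; apply: eq_big_seq => nu nu_c.
rewrite -[LHS]/(mobius a b _).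
have -> : mobius a b (((-1) ^+ e nu *+ c nu) *: (poly_num n nu * poly_vandermonde n))
  = ((-1) ^+ e nu *+ c nu) * mobius a b (poly_num n nu * poly_vandermonde n) :> fps R n.
  by rewrite /mobius mmapZ rmorphMn rmorph_sign.
rewrite mobM mobius_num ?le_S // mobius_vandermonde -/t -/w.
(* The factor t^(K + e) splits into the t^K to be cancelled and t^e, where (-1)^e t^e = (a +
   b)^e. *)
have -> : part_size nu = (K + e nu)%N by have := product_support nu_c; rewrite /K /e; lia.
have tE : ((a + b) ^+ e nu *+ c nu) *: 1 = ((-1) ^+ e nu *+ c nu) * t ^+ e nu.
  by rewrite mulrnAl -exprMn mulN1r /t -scaleNr opprK fps_exprZ1 scalerMnl.
rewrite -mulr_algl tE exprD; move: (_ *+ c nu) (t ^+ K) (t ^+ e nu) => x y z.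
by ring.
Qed.

End Product.

Lemma Zab_two_reg (x : Zab) : x + x = 0 -> x = 0.
Proof.
move=> x2; apply/mpolyP => m; rewrite mcoeff0.
have := congr1 (mcoeff m) x2; rewrite mcoeffD mcoeff0; lia.
Qed.

Lemma Zab_lreg : GRing.lreg (alpha + beta : Zab).
Proof.
apply/(@mulfI {mpoly int[2]})/eqP => /(congr1 (mcoeff U_(ord0))).
rewrite [RHS]mcoeff0 mcoeffD !mcoeffX !eq_mnm1. by move/eqP.
Qed.

Theorem theorem3p3 (la mu : intpart) :
  omega (grothendieck alpha beta la) = grothendieck beta alpha (conj_part la)
  /\
  forall c : {fsfun intpart -> nat with 0%N},
    grothendieck 0 (-1) la * grothendieck 0 (-1) mu
      = \sum_(nu <- finsupp c)
          ((-1) ^+ (part_size nu - part_size la - part_size mu) *+ c nu)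
            *: grothendieck 0 (-1) nu :> symfun int ->
    grothendieck alpha beta la * grothendieck alpha beta mu
      = \sum_(nu <- finsupp c)
          ((alpha + beta) ^+ (part_size nu - part_size la - part_size mu)
             *+ c nu) *: grothendieck alpha beta nu.
Proof.
split; first exact: omega_grothendieck Zab_two_reg.
by move=> c int_product; apply: (grothendieck_mul int_product Zab_lreg).
Qed.
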